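(* Fix an integer $r\ge2$ and a real number $a>0$. For each integer $n\ge2$ let $m_n\in\{1,\dots,n-1\}$, and suppose that, as $n\to\infty$, $$n-m_n\sim a\,n^{1-1/r},\qquad k_n=r .$$ Let $E_r^{(m_n)}$ be the number of elements of $[n]=\{1,\dots,n\}$ belonging to none of $r$ independent uniformly random $m_n$-element subsets of $[n]$. Then $E_r^{(m_n)}$ converges in distribution to the Poisson law with mean $a^r$, and for every fixed integer $p\ge1$, $$\left\lVert (Q_{n,p}^{(m_n)})^{*r}-U_{n,p}\right\rVert_{\mathrm{TV}}\longrightarrow f_p(-r\log a),$$ while $$\mathrm{sep}\!\left((Q_{n,p}^{(m_n)})^{*r},U_{n,p}\right)\longrightarrow\begin{cases}1-e^{-a^r}(1+a^r),&p=1,\\ 1-e^{-a^r},&p\ge2.\end{cases}$$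
   Context: $x_n\sim y_n$ means $x_n/y_n\to1$; $k_n$ denotes the number of steps (here $r$). $G_{n,p}=C_p\wr S_n\cong C_p^n\rtimes S_n$ is the group of $p$-colored permutations, thought of as arrangements of a deck of $n$ cards labelled $1,\dots,n$, each card carrying a color in $C_p=\mathbb{Z}/p\mathbb{Z}$; the identity is the deck in order $1,2,\dots,n$ from top to bottom with all colors $0$. $U_{n,p}$ is the uniform distribution on $G_{n,p}$. One step of the $p$-colored top-$m$-to-random shuffle ($1\le m\le n$): remove the top $m$ cards, recolor those $m$ cards by independent uniform elements of $C_p$, apply a uniform random permutation to the removed block, choose an $m$-element set of final positions uniformly among all $\binom nm$ possibilities, and insert the removed cards into those positions; the remaining $n-m$ cards preserve their relative order and color. $Q_{n,p}^{(m)}$ is the one-step law on $G_{n,p}$, and $(Q_{n,p}^{(m)})^{*k}$ is its $k$-fold convolution power, i.e. the law of the deck after $k$ independent steps started from the identity. $\lVert M-U\rVert_{\mathrm{TV}}=\frac12\sum_x|M(x)-U(x)|$ and $\mathrm{sep}(M,U)=\max_x\left(1-\frac{M(x)}{U(x)}\right)$. With $y_+=\max(y,0)$, for $c\in\mathbb{R}$, $$f_p(c)=\sum_{\ell=0}^\infty a_{\ell,p}\bigl(s_{\ell,p}(e^{-c})-1\bigr)_+,\qquad a_{\ell,p}=\frac1{\ell!\,p^\ell}-\frac1{(\ell+1)!\,p^{\ell+1}},\qquad s_{\ell,p}(\lambda)=e^{-\lambda}\sum_{u=0}^{\ell}(p\lambda)^u .$$ *)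

(* Defs.v *)
From HB Require Import structures.
From mathcomp Require Import all_boot all_order all_algebra all_fingroup.
From mathcomp Require Import all_classical all_reals all_analysis.

Set Implicit Arguments.
Unset Strict Implicit.
Unset Printing Implicit Defensive.

Import Order.TTheory GRing.Theory Num.Theory.
Import numFieldNormedType.Exports.

Local Open Scope ring_scope.

(* C_p = Z/pZ for p >= 1, under addition.  'Z_p is not usable here, because
   'Z_1 denotes Z/2Z; for p = 0 this is the trivial group. *)
Definition color (p : nat) : Type := 'I_p.-1.+1.
HB.instance Definition _ p := Finite.on (color p).
HB.instance Definition _ p := GRing.Zmodule.on (color p).

(* An arrangement of the deck: from top to bottom, position i holds the card
   card_at g i, with the color color_at g i. *)
Record colored_perm (n p : nat) : Type := ColoredPerm {
  card_at : 'S_n;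
  color_at : {ffun 'I_n -> color p}
}.

Section ColoredPermGroup.
Variables n p : nat.
Local Notation G := (colored_perm n p).

Definition pair_of_colored_perm (g : G) := (card_at g, color_at g).
Definition colored_perm_of_pair (u : 'S_n * {ffun 'I_n -> color p}) : G :=
  ColoredPerm u.1 u.2.

Lemma pair_of_colored_permK :
  cancel pair_of_colored_perm colored_perm_of_pair.
Proof. by case. Qed.

HB.instance Definition _ := Finite.copy G (can_type pair_of_colored_permK).

Definition colored_one : G := ColoredPerm 1%g [ffun=> 0].

(* Multiplying g by h on the right rearranges the deck g according to h: the
   card in position i of the new deck is the one in position card_at h i of
   g, and color_at h i is added to its color.  (In MathComp, (s * t)%g i is
   t (s i).) *)
Definition colored_mul (g h : G) : G :=
  ColoredPerm (card_at h * card_at g)%g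
    [ffun i => color_at g (card_at h i) + color_at h i].

Definition colored_inv (g : G) : G :=
  ColoredPerm (card_at g)^-1%g [ffun i => - color_at g ((card_at g)^-1%g i)].

Lemma colored_mulA : associative colored_mul.
Proof.
move=> [s x] [t y] [u z]; rewrite /colored_mul /= mulgA; congr ColoredPerm.
by apply/ffunP => i; rewrite !ffunE /= permM addrA.
Qed.

Lemma colored_mul1 : left_id colored_one colored_mul.
Proof.
move=> [s x]; rewrite /colored_mul /= mulg1; congr ColoredPerm.
by apply/ffunP => i; rewrite !ffunE add0r.
Qed.

Lemma colored_mulV : left_inverse colored_one colored_inv colored_mul.
Proof.
move=> [s x]; rewrite /colored_mul /= mulgV; congr ColoredPerm.
by apply/ffunP => i; rewrite !ffunE permK addNr.
Qed.

HB.instance Definition _ :=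
  Finite_isGroup.Build G colored_mulA colored_mul1 colored_mulV.

End ColoredPermGroup.

Section FiniteLaws.
Variable R : realType.

Definition unif (T : finType) (A : {set T}) : T -> R :=
  fun x => if x \in A then #|A|%:R^-1 else 0.

Definition push (T T' : finType) (M : T -> R) (X : T -> T') : T' -> R :=
  fun y => \sum_(x | X x == y) M x.

Definition convolution (gT : finGroupType) (M N : gT -> R) : gT -> R :=
  fun g => \sum_(h : gT) M h * N (h^-1 * g)%g.

Definition convolution_pow (gT : finGroupType) (M : gT -> R) (k : nat) : gT -> R :=
  iter k (convolution M) (unif [set 1%g]).

Definition tv (T : finType) (M U : T -> R) : R :=
  2^-1 * \sum_(x : T) `|M x - U x|.

(* The maximum over the whole group; the default value of the iterated
   maximum is the term at the identity, so that it does not affect it. *)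
Definition sep (gT : finGroupType) (M U : gT -> R) : R :=
  \big[Num.max/1 - M 1%g / U 1%g]_(x : gT) (1 - M x / U x).

Definition cdf_fin (T : finType) (M : T -> R) (X : T -> R) : R -> R :=
  fun x => \sum_(w | X w <= x) M w.

(* Convergence in distribution of real random variables, in terms of their
   distribution functions F n and of the limiting one F0. *)
Definition cvg_in_distribution (F : nat -> R -> R) (F0 : R -> R) : Prop :=
  forall x : R, {for x, continuous F0} ->
    (F n x @[n --> \oo] --> F0 x)%classic.

(* The last argument 0 of poisson_prob is unused in its definition. *)
Definition poisson_cdf (lambda : R) : R -> R :=
  fun x => fine (poisson_prob lambda 0 [set k : nat | k%:R <= x]%classic).

Definition asym_equiv (x y : nat -> R) : Prop :=
  (x n / y n @[n --> \oo] --> (1 : R))%classic.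

End FiniteLaws.

Arguments unif R {T} A _.

Section Insertion.
Variable n : nat.
Implicit Types (A : {set 'I_n}) (i j : 'I_n).

Definition rank_in A i : nat := #|[set j in A | (j < i)%N]|.

(* The top #|A| cards are inserted, in order, into the positions in A, and
   the other cards fill the other positions, in order: the final position i
   receives the card that was in position insert_from A i. *)
Definition insert_from A i : nat :=
  if i \in A then rank_in A i else (#|A| + rank_in (~: A) i)%N.

Lemma rank_in_lt A i : i \in A -> (rank_in A i < #|A|)%N.
Proof.
move=> iA; apply: proper_card; apply/fintype.properP; split.
  by apply/fintype.subsetP => j; rewrite inE => /andP[].
by exists i; rewrite // inE ltnn andbF.
Qed.

Lemma rank_in_mono A i j : i \in A -> (i < j)%N -> (rank_in A i < rank_in A j)%N.
Proof.
move=> iA ij; apply: proper_card; apply/fintype.properP; split.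
  apply/fintype.subsetP => k; rewrite !inE => /andP[-> ki] /=; exact: ltn_trans ki ij.
by exists i; rewrite !inE ?iA ?ltnn.
Qed.

Lemma rank_in_inj A : {in A &, injective (rank_in A)}.
Proof.
move=> i j iA jA e; apply: val_inj; case: (ltngtP i j) => // ij.
  by have := rank_in_mono iA ij; rewrite e ltnn.
by have := rank_in_mono jA ij; rewrite e ltnn.
Qed.

Lemma insert_from_lt A i : (insert_from A i < n)%N.
Proof.
rewrite /insert_from; case: ifPn => [iA | iA].
  by rewrite (leq_trans (rank_in_lt iA)) // -[leqRHS]card_ord max_card.
by rewrite -[ltnRHS]card_ord -(cardsC A) ltn_add2l rank_in_lt // inE.
Qed.

Definition insert_ord A i : 'I_n := Ordinal (insert_from_lt A i).

Lemma insert_ord_inj A : injective (insert_ord A).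
Proof.
move=> i j /(congr1 val) /=; rewrite /insert_from.
case: ifPn => iA; case: ifPn => jA.
- exact: rank_in_inj.
- by move=> e; have := rank_in_lt iA; rewrite e ltnNge leq_addr.
- by move=> e; have := rank_in_lt jA; rewrite -e ltnNge leq_addr.
- by move/addnI; apply: rank_in_inj; rewrite inE.
Qed.

Definition insert_perm A : 'S_n := perm (@insert_ord_inj A).

End Insertion.

Section TopToRandom.
Variables (R : realType) (n p m : nat).

Definition msubsets : {set {set 'I_n}} := [set A : {set 'I_n} | #|A| == m].

Definition top_block : {set 'I_n} := [set i : 'I_n | (i < m)%N].

Definition block_colorings : {set {ffun 'I_n -> color p}} :=
  [set c : {ffun 'I_n -> color p} | [forall i, (i \in top_block) || (c i == 0)]].

(* The random choices of one step: new colors for the removed cards, a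
   permutation of the removed block, and the final positions of the removed
   cards; independent and uniform choices amount to the uniform law on the
   product. *)
Definition step_choices :
    {set {ffun 'I_n -> color p} * 'S_n * {set 'I_n}} :=
  finset.setX (finset.setX block_colorings (Sym top_block)) msubsets.

(* Recolor, then permute the block, then insert. *)
Definition step_of (w : {ffun 'I_n -> color p} * 'S_n * {set 'I_n}) :
    colored_perm n p :=
  (ColoredPerm 1%g w.1.1 * ColoredPerm w.1.2 [ffun=> 0]
    * ColoredPerm (insert_perm w.2) [ffun=> 0])%g.

Definition top_to_random : colored_perm n p -> R :=
  push (unif R step_choices) step_of.

Definition colored_uniform : colored_perm n p -> R := unif R [set: colored_perm n p].

(* The joint law of r independent uniformly random m-element subsets. *)
Definition indep_msubsets (r : nat) (S : {ffun 'I_r -> {set 'I_n}}) : R :=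
  \prod_(i < r) unif R msubsets (S i).

End TopToRandom.

Arguments top_to_random R n p m _ : clear implicits.
Arguments colored_uniform R n p _ : clear implicits.
Arguments indep_msubsets R n m r _ : clear implicits.

Definition num_missed (n r : nat) (S : {ffun 'I_r -> {set 'I_n}}) : nat :=
  #|[set x : 'I_n | [forall i, x \notin S i]]|.

(* The distribution function of the number E_r^(m) of elements of [n] missed
   by r independent uniformly random m-element subsets. *)
Definition missed_cdf (R : realType) (n m r : nat) : R -> R :=
  cdf_fin (indep_msubsets R n m r) (fun S => (num_missed S)%:R).

Arguments missed_cdf R n m r _ : clear implicits.

Section LimitProfile.
Variable R : realType.

Definition coef_a (p l : nat) : R :=
  (l`!%:R * p%:R ^+ l)^-1 - (l.+1`!%:R * p%:R ^+ l.+1)^-1.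

Definition coef_s (p l : nat) (lambda : R) : R :=
  expR (- lambda) * \sum_(0 <= u < l.+1) (p%:R * lambda) ^+ u.

Definition profile_f (p : nat) (c : R) : R :=
  limn (series (fun l =>
    coef_a p l * Num.max (coef_s p l (expR (- c)) - 1) 0)).

End LimitProfile.

(* Main.v *)
Require Import Defs.
From HB Require Import structures.
From mathcomp Require Import all_boot all_order all_algebra all_fingroup.
From mathcomp Require Import all_classical all_reals all_analysis.
From mathcomp Require Import ring lra zify.
Import Order.TTheory GRing.Theory Num.Theory.
Import numFieldNormedType.Exports.

(** The whole problem reduces to one integer statistic.  Say that a deck lies
    in the suffix class V_e when its last e cards, those labelled n-e+1,...,n,
    occur in increasing order and all have color 0.  A deck produced by one
    top-m-to-random step from the identity is exactly a uniform element of
    V_(n-m) ([top_to_randomE]): the untouched cards keep their order and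
    color, and everything else is uniform.

    The uniform laws on the classes V_e are closed under convolution
    ([convolution_suffix_sorted]): unif V_d * unif V_f is the mixture of the
    unif V_e in which e has the hypergeometric law of the number of marked
    points in a random f-subset of [n], with d points marked.  Hence the law
    after r steps is a mixture of the unif V_e, whose weights follow a Markov
    recursion.  The binomial moments of these weights satisfy a product
    formula, the same as those of the number E of points missed by r random
    m-subsets; since binomial moments determine a law on {0,...,n}
    ([binomial_inversion]), the weights are P(E = e)
    ([untouched_weightE]).

    As |V_e| = |G| / (e! p^e), the density of the law with respect to the
    uniform one, at a deck of suffix length l (the largest e with the deck in
    V_e), is S_l = sum over e <= l of P(E = e) e! p^e.  Under the uniform law
    the suffix length equals l with probability a_(l,p) when l < n.
    Therefore the total variation distance is the sum over l of
    a_(l,p) (S_l - 1)_+, up to the boundary term l = n.  As S_l increases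
    with l, the separation is 1 - S_0, except that for p = 1 every deck has
    suffix length at least 1, and then it is 1 - S_1.

    It remains to let n grow.  The t-th binomial moment of E is
    1/t! times a product of t factors, each of which tends to a^r and is at
    most n ((n-m)/n)^r.  So the moments tend to those of the Poisson law of
    mean a^r and are dominated by B^t/t!, with B = a^r + 1.  Tannery's theorem
    ([tannery]), applied to the inversion formula, gives the Poisson limit of
    P(E = e) ([missed_pmf_cvg]); applied once more, with the domination
    S_l <= (1 + pB)^l, it gives the limit of the total variation distance
    ([tv_cvg]). *)

Set Implicit Arguments.
Unset Strict Implicit.
Unset Printing Implicit Defensive.

Local Open Scope ring_scope.

(** * Rearranging a set of cards *)

Section Patterns.
Variables n p : nat.
Local Notation G := (colored_perm n p).
Implicit Types (A B F : {set 'I_n}) (c g x y z : G) (a b : 'I_n).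

Definition pos_of x a : 'I_n := ((card_at x)^-1)%g a.
Definition color_of x a : color p := color_at x (pos_of x a).

(** Both conditions that matter below have this form: h lies in a suffix class
    iff it has the pattern of the identity there, and h^-1 g lies in one iff h
    and g have the same pattern on the bottom cards of h.  This makes a product
    condition on h and h^-1 g into two conditions on the single deck h. *)
Definition same_pattern A x y : bool :=
  [forall a in A, (color_of x a == color_of y a) &&
    [forall b in A, (pos_of x a < pos_of x b)%N == (pos_of y a < pos_of y b)%N]].

(** Acting on the left, these elements permute and recolor the cards of A among
    the positions that these cards occupy, and leave the other cards alone. *)
Definition supported A : {set G} :=
  [set c | [forall a, (a \in A) || (card_at c a == a) && (color_at c a == 0)]].

Lemma same_patternP A x y :
  reflect ((forall a, a \in A -> color_of x a = color_of y a) /\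
           (forall a b, a \in A -> b \in A ->
              (pos_of x a < pos_of x b)%N = (pos_of y a < pos_of y b)%N))
          (same_pattern A x y).
Proof.
apply: (iffP 'forall_in_andP) => [H|[H1 H2] a aA]; last first.
  by split; [rewrite H1|apply/forall_inP => b bA; rewrite H2].
split=> [a /H[/eqP//]|a b aA bA]; have [_ /forall_inP/(_ b bA)/eqP//] := H a aA.
Qed.

Lemma same_pattern_sym A x y : same_pattern A x y = same_pattern A y x.
Proof.
by apply/same_patternP/same_patternP => -[H1 H2]; split=> *; rewrite ?H1 ?H2.
Qed.

Lemma same_pattern_trans A x y z :
  same_pattern A x y -> same_pattern A x z = same_pattern A y z.
Proof.
move=> /same_patternP[H1 H2].
apply/same_patternP/same_patternP => -[H3 H4]; split=> *.
- by rewrite -H1 ?H3.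
- by rewrite -H2 ?H4.
- by rewrite H1 ?H3.
- by rewrite H2 ?H4.
Qed.

Lemma same_pattern_sub A B x y :
  A \subset B -> same_pattern B x y -> same_pattern A x y.
Proof.
move=> /fintype.subsetP sAB /same_patternP[H1 H2].
by apply/same_patternP; split=> *; rewrite ?H1 ?H2 ?sAB.
Qed.

Lemma card_at_mul x y i : card_at (x * y)%g i = card_at x (card_at y i).
Proof. by rewrite /= permM. Qed.

Lemma color_at_mul x y i :
  color_at (x * y)%g i = color_at x (card_at y i) + color_at y i.
Proof. by rewrite /= ffunE. Qed.

Lemma color_at1 i : color_at (1%g : G) i = 0.
Proof. by rewrite /= ffunE. Qed.

Lemma pos_ofK x : cancel (pos_of x) (card_at x).
Proof. by move=> a; rewrite /pos_of permKV. Qed.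

Lemma card_atK x : cancel (card_at x) (pos_of x).
Proof. by move=> a; rewrite /pos_of permK. Qed.

Lemma pos_of_inj x : injective (pos_of x).
Proof. exact: perm_inj. Qed.

Lemma pos_of1 a : pos_of 1%g a = a.
Proof. by rewrite /pos_of invg1 perm1. Qed.

Lemma color_of1 a : color_of 1%g a = 0.
Proof. by rewrite /color_of color_at1. Qed.

Lemma pos_of_mul z x a : pos_of (z * x)%g (card_at z a) = pos_of x a.
Proof. by apply: (can_inj (card_atK (z * x)%g)); rewrite pos_ofK card_at_mul pos_ofK. Qed.

Lemma color_of_mul z x a :
  color_of (z * x)%g (card_at z a) = color_at z a + color_of x a.
Proof. by rewrite /color_of pos_of_mul color_at_mul pos_ofK. Qed.

Lemma colored_perm_eq x y :
  (forall i, card_at x i = card_at y i) -> (forall i, color_at x i = color_at y i) ->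
  x = y.
Proof. by case: x y => [s u] [t v] /= /permP-> /ffunP->. Qed.

(** Left multiplication relabels the cards and shifts the colors of each card by
    the same amount in both decks, without moving any position. *)
Lemma same_pattern_mul z A x y :
  same_pattern (card_at z @: A) (z * x)%g (z * y)%g = same_pattern A x y.
Proof.
apply/same_patternP/same_patternP => -[H1 H2]; split.
- by move=> a aA; apply: (addrI (color_at z a)); rewrite -!color_of_mul H1 ?imset_f.
- by move=> a b aA bA; rewrite -(pos_of_mul z x a) -(pos_of_mul z x b) -(pos_of_mul z y a) -(pos_of_mul z y b) H2 ?imset_f.
- by move=> _ /imsetP[a aA ->]; rewrite !color_of_mul H1.
- by move=> _ _ /imsetP[a aA ->] /imsetP[b bA ->]; rewrite !pos_of_mul H2.
Qed.

Lemma supportedP A c :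
  reflect (forall a, a \notin A -> card_at c a = a /\ color_at c a = 0)
          (c \in supported A).
Proof.
rewrite inE; apply: (iffP forallP) => H a.
  by move=> /negPf aA; have := H a; rewrite aA => /andP[/eqP-> /eqP->].
by case: (boolP (a \in A)) => //= /H[-> ->]; rewrite !eqxx.
Qed.

Lemma supported_on A c : c \in supported A -> perm_on A (card_at c).
Proof.
move=> /supportedP cA; apply/fintype.subsetP => a; rewrite inE.
by apply: contraNT => /cA[->].
Qed.

Lemma pos_of_supported A c x a :
  c \in supported A -> a \notin A -> pos_of (c * x)%g a = pos_of x a.
Proof. by move=> /supportedP cA /cA[e _]; rewrite -[in LHS]e pos_of_mul. Qed.

Lemma color_of_supported A c x a :
  c \in supported A -> a \notin A -> color_of (c * x)%g a = color_of x a.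
Proof. by move=> /supportedP cA /cA[e e0]; rewrite -[in LHS]e color_of_mul e0 add0r. Qed.

Lemma same_pattern_supported A B c x y : [disjoint A & B] ->
  c \in supported A -> same_pattern B (c * x)%g y = same_pattern B x y.
Proof.
move=> dAB cA; apply: same_pattern_trans; apply/same_patternP.
have nA a : a \in B -> a \notin A by move=> aB; rewrite (disjointFl dAB).
by split=> [a /nA aA|a b /nA aA /nA bA]; rewrite ?(color_of_supported _ cA) ?(pos_of_supported _ cA).
Qed.

Lemma insert_ord_lt_card A i : (insert_ord A i < #|A|)%N = (i \in A).
Proof.
rewrite /= /insert_from; case: ifPn => [/rank_in_lt//|_].
by rewrite ltnNge leq_addr.
Qed.

Lemma insert_from_mono A i j : (i \in A) = (j \in A) ->
  (insert_from A i < insert_from A j)%N = (i < j)%N.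
Proof.
move=> eij; rewrite /insert_from -eij.
have mono B : i \in B -> j \in B -> (rank_in B i < rank_in B j)%N = (i < j)%N.
  move=> iB jB; apply/idP/idP; last exact: rank_in_mono.
  case: (ltngtP i j) => // [ji|/val_inj->]; last by rewrite ltnn.
  by move/(ltn_trans (rank_in_mono jB ji)); rewrite ltnn.
case: ifPn => iA; first by rewrite mono // -eij.
by rewrite ltn_add2l mono // inE -?eij.
Qed.

Definition rank_of A x a : nat := #|[set b in A | (pos_of x b < pos_of x a)%N]|.

(** The rank of a card of A is the coordinate that determines it, which is what
    makes the rearrangement below unique. *)
Lemma rank_of_inj A x : {in A &, injective (rank_of A x)}.
Proof.
have lt a b : a \in A -> (pos_of x a < pos_of x b)%N -> (rank_of A x a < rank_of A x b)%N.
  move=> aA ab; apply: proper_card; apply/fintype.properP; split.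
    by apply/fintype.subsetP => k; rewrite !inE => /andP[-> ka] /=; exact: ltn_trans ab.
  by exists a; rewrite !inE ?aA ?ab ?ltnn ?andbF.
move=> a b aA bA e; case: (ltngtP (pos_of x a) (pos_of x b)).
- by move/(lt _ _ aA); rewrite e ltnn.
- by move/(lt _ _ bA); rewrite e ltnn.
- by move/val_inj/pos_of_inj.
Qed.

Lemma rank_of_pattern A x y a :
  same_pattern A x y -> a \in A -> rank_of A x a = rank_of A y a.
Proof.
move=> /same_patternP[_ H] aA; apply: eq_card => b; rewrite !inE.
by case: (boolP (b \in A)) => //= bA; rewrite H.
Qed.

Lemma rank_of_supported A c x a :
  c \in supported A -> rank_of A (c * x)%g (card_at c a) = rank_of A x a.
Proof.
move=> cA; rewrite /rank_of -[RHS](card_imset _ (@perm_inj _ (card_at c))).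
apply: eq_card => b; rewrite -(permKV (card_at c) b) (mem_imset _ _ (@perm_inj _ (card_at c))) !inE.
by rewrite !pos_of_mul perm_closed ?supported_on.
Qed.

(** A rearrangement carries each card to the card whose rank in y is the rank of
    the original card in x, so the pattern leaves no choice. *)
Lemma rearrangement_unique A x y c c' :
  c \in supported A -> c' \in supported A ->
  same_pattern A (c * x)%g y -> same_pattern A (c' * x)%g y -> c = c'.
Proof.
move=> cA c'A m m'.
have e a : card_at c a = card_at c' a.
  case: (boolP (a \in A)) => aA; last first.
    by move: cA c'A => /supportedP/(_ _ aA)[-> _] /supportedP/(_ _ aA)[-> _].
  have ca : card_at c a \in A by rewrite perm_closed ?supported_on.
  have c'a : card_at c' a \in A by rewrite perm_closed ?supported_on.
  apply: (@rank_of_inj A y) => //.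
  by rewrite -(rank_of_pattern m ca) rank_of_supported // -(rank_of_pattern m' c'a) rank_of_supported.
apply: colored_perm_eq => // a.
case: (boolP (a \in A)) => aA; last first.
  by move: cA c'A => /supportedP/(_ _ aA)[_ ->] /supportedP/(_ _ aA)[_ ->].
have ca : card_at c a \in A by rewrite perm_closed ?supported_on.
apply: (addIr (color_of x a)); rewrite -[LHS]color_of_mul -[RHS]color_of_mul -e.
by move: m m' => /same_patternP[/(_ _ ca)-> _] /same_patternP[/(_ _ ca)-> _].
Qed.

(** The insertion permutation of a set of positions is an order isomorphism from
    that set to an initial segment, so going through these segments matches
    the positions of A in x and in y in increasing order. *)
Lemma rearrangement_exists A x y :
  exists2 c, c \in supported A & same_pattern A (c * x)%g y.
Proof.
pose P z := pos_of z @: A.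
have PE z a : (pos_of z a \in P z) = (a \in A) by rewrite mem_imset //; exact: pos_of_inj.
have cP z : #|P z| = #|A| by rewrite card_imset //; exact: pos_of_inj.
(* Card a goes to the card of y at the position that corresponds to that of a. *)
pose s : 'S_n := ((card_at x)^-1 * insert_perm (P x) * (insert_perm (P y))^-1 * card_at y)%g.
have ins z i : insert_perm (P z) i = insert_ord (P z) i by rewrite permE.
have posE a : insert_perm (P y) (pos_of y (s a)) = insert_perm (P x) (pos_of x a).
  by rewrite /s !permM /pos_of permK permKV.
have sA a : (s a \in A) = (a \in A).
  by rewrite -(PE y (s a)) -(PE x a) -2!insert_ord_lt_card 2!cP -2!ins posE.
have sN : s \in ('N(A | 'P))%g.
  rewrite !inE /=; apply/fintype.subsetP => a aA; rewrite inE /= /aperm sA //.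
pose c : G := ColoredPerm (restr_perm A s)
   [ffun a => if a \in A then color_of y (s a) - color_of x a else 0].
have cs a : a \in A -> card_at c a = s a by move=> aA; rewrite /= restr_permE.
exists c.
  apply/supportedP => a aA /=; rewrite (out_perm (restr_perm_on _ _)) //.
  by rewrite ffunE (negPf aA).
have onto b : b \in A -> exists2 a, a \in A & b = card_at c a.
  move=> bA; exists (s^-1 b)%g; first by rewrite -sA permKV.
  by rewrite cs ?permKV // -sA permKV.
apply/same_patternP; split=> [_ /onto[a aA ->]|_ _ /onto[a aA ->] /onto[b bA ->]].
  by rewrite color_of_mul /= ffunE aA subrK cs.
rewrite !pos_of_mul !cs // -(@insert_from_mono (P x)) ?PE ?aA ?bA //.
rewrite -[RHS](@insert_from_mono (P y)) ?PE ?sA ?aA ?bA //.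
have := posE a; have := posE b; rewrite !ins => /(congr1 val) /= -> /(congr1 val) /= -> //.
Qed.

Lemma card_matching_rearrangements A x y :
  #|[set c in supported A | same_pattern A (c * x)%g y]| = 1%N.
Proof.
have [c cA cm] := rearrangement_exists A x y.
suff -> : [set c in supported A | same_pattern A (c * x)%g y] = [set c] by rewrite cards1.
apply/setP => d; rewrite finset.in_set [in RHS]inE.
apply/andP/eqP => [[dA dm]|->//]; exact: rearrangement_unique dA cA dm cm.
Qed.

(** The counting principle behind all cardinalities below: the left action of the
    elements supported on A is free, and each of its orbits contains exactly
    one deck with the prescribed pattern, so fixing the pattern on A divides
    the size of an invariant set by the number of such elements. *)
Lemma card_pattern_class (X : {set G}) A y :
  (forall c x, c \in supported A -> ((c * x)%g \in X) = (x \in X)) ->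
  #|X| = (#|supported A| * #|[set x in X | same_pattern A x y]|)%N.
Proof.
move=> cX; rewrite -[LHS]sum1_card.
under eq_bigr => x _ do rewrite -(card_matching_rearrangements A x y) -sum1dep_card big_mkcondr /=.
rewrite exchange_big /= -sum_nat_const; apply: eq_bigr => c cA.
rewrite -sum1dep_card big_mkcondr /= [RHS](reindex_inj (mulgI c)) /=.
by apply: eq_bigl => x; rewrite cX.
Qed.

Lemma card_supported A : #|supported A| = ((#|A|)`! * p.-1.+1 ^ #|A|)%N.
Proof.
have inj : injective (@pair_of_colored_perm n p) := can_inj (@pair_of_colored_permK n p).
have card_color : #|{: color p}| = p.-1.+1 by exact: card_ord.
rewrite -(card_perm A) -card_color -(@card_pffun_on _ _ (0 : color p) A predT) -cardX.
rewrite -(card_imset _ inj).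
apply: eq_card => -[s f]; rewrite inE /=; apply/imsetP/andP.
  move=> [c cA [-> ->]]; split; first exact: (supported_on cA).
  apply/pffun_onP; split=> //; apply/fintype.subsetP => a; rewrite inE.
  by apply: contraNT => /(supportedP _ _ cA)[_ ->].
move=> [sA /pffun_onP[/fintype.subsetP fA _]]; exists (ColoredPerm s f) => //.
apply/supportedP => a aA /=; rewrite (out_perm sA) //; split=> //.
by apply/eqP; apply: contraNT aA => fa; apply: fA; rewrite inE.
Qed.

Lemma card_colored_perm : #|{: G}| = (n`! * p.-1.+1 ^ n)%N.
Proof.
have := card_supported [set: 'I_n]; rewrite cardsT card_ord => <-.
by rewrite -cardsT; apply: eq_card => c; rewrite !inE; apply/esym/forallP => a; rewrite inE.
Qed.

End Patterns.

(** * Decks whose last cards are sorted *)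

Section SuffixClasses.
Import mathcomp.boot.fintype mathcomp.boot.finset.
Variables n p : nat.
Local Notation G := (colored_perm n p).
Local Notation q := p.-1.+1.
Implicit Types (A F : {set 'I_n}) (g h x z : G) (d e f : nat) (a b : 'I_n).

Definition last_cards e : {set 'I_n} := [set i : 'I_n | (n - e <= i)%N].

Definition suffix_sorted e : {set G} := [set g | same_pattern (last_cards e) g 1%g].

Lemma card_last_cards e : (e <= n)%N -> #|last_cards e| = e.
Proof.
move=> en; rewrite -sum1dep_card -(big_geq_mkord (n - e) n xpredT (fun=> 1%N)).
by rewrite sum_nat_const_nat muln1 subKn.
Qed.

Lemma last_cards_sub d e : (d <= e)%N -> last_cards d \subset last_cards e.
Proof.
move=> de; apply/subsetP => i; rewrite !inE; apply: leq_trans.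
exact: leq_sub2l.
Qed.

(** If a lies in A, so do the n - a labels from a on; hence a >= n - #|A|, and
    the inclusion obtained in this way is an equality by cardinality. *)
Lemma up_closed_last_cards A :
  (forall a b : 'I_n, a \in A -> (a <= b)%N -> b \in A) -> A = last_cards #|A|.
Proof.
move=> up; apply/eqP; rewrite eqEcard card_last_cards ?leqnn ?andbT; last first.
  by rewrite -[leqRHS]card_ord max_card.
apply/subsetP => a aA; rewrite inE leq_subLR addnC -leq_subLR.
rewrite -(card_last_cards (leq_subr a n)) subset_leq_card //.
apply/subsetP => b; rewrite inE subKn; last exact: ltnW.
exact: up.
Qed.

Lemma mem_suffix_sorted e g :
  (g \in suffix_sorted e) = same_pattern (last_cards e) g 1%g.
Proof. by rewrite in_set. Qed.

Lemma suffix_sorted_sub d e : (d <= e)%N -> suffix_sorted e \subset suffix_sorted d.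
Proof.
move=> de; apply/subsetP => g; rewrite !mem_suffix_sorted.
exact/same_pattern_sub/last_cards_sub.
Qed.

Lemma card_suffix_sorted e : (e <= n)%N ->
  #|{: G}| = (e`! * q ^ e * #|suffix_sorted e|)%N.
Proof.
move=> en; have := @card_pattern_class n p [set: G] (last_cards e) 1%g.
rewrite cardsT card_supported card_last_cards // => -> => [|c x _]; last by rewrite !inE.
by congr (_ * _)%N; apply: eq_card => x; rewrite mem_suffix_sorted in_set inE.
Qed.

Definition bottom_cards f h : {set 'I_n} := card_at h @: last_cards f.

Lemma bottom_mul f z h : bottom_cards f (z * h)%g = card_at z @: bottom_cards f h.
Proof.
by rewrite /bottom_cards -imset_comp; apply: eq_imset => i; rewrite card_at_mul.
Qed.

Lemma card_bottom f h : (f <= n)%N -> #|bottom_cards f h| = f.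
Proof. by move=> fn; rewrite card_imset ?card_last_cards //; exact: perm_inj. Qed.

Lemma mem_bottom f h a : (a \in bottom_cards f h) = (n - f <= pos_of h a)%N.
Proof.
rewrite -{1}(pos_ofK h a) mem_imset ?inE //; exact: perm_inj.
Qed.

Lemma bottom_supported f F A c x : c \in supported p A ->
  A \subset F \/ [disjoint A & F] ->
  (bottom_cards f (c * x)%g == F) = (bottom_cards f x == F).
Proof.
move=> cA AF.
have cF : card_at c @: F = F.
  case: AF => [AF|dAF]; first exact/im_perm_on/(subset_trans (supported_on cA)).
  rewrite -[RHS]imset_id; apply: eq_in_imset => a aF.
  by move: cA => /supportedP/(_ a)[] //; rewrite (disjointFl dAF).
rewrite bottom_mul -[in LHS]cF; apply/eqP/eqP => [|-> //].
by apply: imset_inj; exact: perm_inj.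
Qed.

(** By symmetry: relabelling the cards carries the decks with bottom set E to
    those with any other bottom set of the same size, so that the bottom set
    of a uniform deck is a uniform f-subset. *)
Lemma card_bottom_class f F : (f <= n)%N -> #|F| = f ->
  ('C(n, f) * #|[set h : G | bottom_cards f h == F]|)%N = #|{: G}|.
Proof.
move=> fn cF.
(* The insertion permutation of E, as a relabelling, carries E to an initial segment. *)
have class (E : {set 'I_n}) : #|E| = f -> #|[set h : G | bottom_cards f h == E]|
    = #|[set h : G | bottom_cards f h == top_block n f]|.
  move=> cE; pose z : G := ColoredPerm (insert_perm E) [ffun=> 0].
  rewrite -(card_imset _ (mulgI z)); apply: eq_card => h.
  rewrite -(mulKVg z h) (mem_imset _ _ (mulgI z)); move: (z^-1 * h)%g => y.
  rewrite !inE bottom_mul.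
  have -> : top_block n f = card_at z @: E.
    apply/setP => i; rewrite -(permKV (insert_perm E) i) inE /= mem_imset; last exact: perm_inj.
    by rewrite permE -[in LHS]cE insert_ord_lt_card.
  by apply/eqP/eqP => [->//|]; apply: imset_inj; exact: perm_inj.
rewrite -[RHS]sum1_card (partition_big (bottom_cards f) (fun E : {set 'I_n} => #|E| == f)) /=; last first.
  by move=> h _; rewrite card_bottom.
under eq_bigr => E /eqP cE.
  rewrite sum1dep_card (class E cE) -(class F cF); over.
by rewrite sum_nat_cond_const card_draws card_ord.
Qed.

Lemma bottom_classP f g h :
  ((h^-1 * g)%g \in suffix_sorted f) = same_pattern (bottom_cards f h) h g.
Proof.
rewrite mem_suffix_sorted -(same_pattern_mul h) mulKVg mulg1.
exact: same_pattern_sym.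
Qed.

(** The decks h with bottom set F that contribute to the value at g of the
    convolution of the uniform laws on two suffix classes. *)
Definition bottom_matching d f g F : {set G} :=
  [set h | [&& bottom_cards f h == F, h \in suffix_sorted d & same_pattern F h g]].

(** The cards of F lie below all others, so when the last d cards are in
    increasing order, those among them that lie in F are the largest. *)
Lemma bottom_matching_suffix d f g h F :
  h \in bottom_matching d f g F -> F :&: last_cards d = last_cards #|F :&: last_cards d|.
Proof.
rewrite inE => /and3P[/eqP bF hd _]; apply: up_closed_last_cards => a b.
rewrite !inE => /andP[aF ad] ab; have bd := leq_trans ad ab; rewrite bd andbT.
move: hd ab; rewrite mem_suffix_sorted leqNgt => /same_patternP[_ /(_ b a)].
rewrite !inE !pos_of1 => <- //; move: aF; rewrite -bF !mem_bottom -leqNgt.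
exact: leq_trans.
Qed.

(** Once the bottom set F meets the last d cards in the last e ones, the order
    between these e cards and the remaining d - e is automatic; the e cards
    are read off from g, and the d - e other cards are unconstrained by g. *)
Lemma suffix_sorted_bottom d e f g h F : bottom_cards f h = F -> same_pattern F h g ->
  F :&: last_cards d = last_cards e ->
  (h \in suffix_sorted d) =
  (g \in suffix_sorted e) && same_pattern (last_cards d :\: F) h 1%g.
Proof.
move=> bF hg Fd; have eF : last_cards e \subset F by rewrite -Fd subsetIl.
rewrite !mem_suffix_sorted -(same_pattern_trans _ (same_pattern_sub eF hg)).
apply/idP/andP => [hd|[he /same_patternP[hD hD']]].
  split; apply: same_pattern_sub hd; last exact: subsetDl.
  by rewrite -Fd subsetIr.
have memF a : (a \in F) = (n - f <= pos_of h a)%N by rewrite -bF mem_bottom.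
have meme a : a \in last_cards d -> (a \in last_cards e) = (a \in F).
  by move=> ad; rewrite -Fd inE ad andbT.
have cross a b : a \in last_cards d -> b \in last_cards d -> a \notin F -> b \in F ->
    (pos_of h a < pos_of h b)%N && (a < b)%N.
  move=> ad bd aF bF'; apply/andP; split.
    by move: aF bF'; rewrite !memF -ltnNge; exact: leq_trans.
  by move: aF bF'; rewrite -!meme // !inE -ltnNge; exact: leq_trans.
move: he => /same_patternP[he he'].
apply/same_patternP; split=> [a ad|a b ad bd].
  by case: (boolP (a \in F)) => aF; [apply: he; rewrite meme|apply: hD; rewrite inE aF].
case: (boolP (a \in F)) => aF; case: (boolP (b \in F)) => bF'.
- by apply: he'; rewrite meme.
- have /andP[ba ba'] := cross b a bd ad bF' aF.
  by rewrite !pos_of1 ltnNge (ltnW ba) /= ltnNge (ltnW ba').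
- by have /andP[ab ab'] := cross a b ad bd aF bF'; rewrite !pos_of1 ab ab'.
- by apply: hD'; rewrite inE ?aF ?bF'.
Qed.

(** Two applications of [card_pattern_class], to the disjoint sets of cards F and
    the rest of the last d cards: the two patterns are independent of each
    other and of the bottom set. *)
Lemma card_bottom_matching d e f g F : (d <= n)%N -> (f <= n)%N -> (e <= d)%N ->
  #|F| = f -> F :&: last_cards d = last_cards e ->
  ('C(n, f) * ((d - e)`! * q ^ (d - e)) * (f`! * q ^ f) * #|bottom_matching d f g F|)%N
  = ((g \in suffix_sorted e) * #|{: G}|)%N.
Proof.
move=> dn fn ed cF Fd; have en := leq_trans ed dn.
case: (boolP (g \in suffix_sorted e)) => ge; last first.
  rewrite mul0n; apply/eqP; rewrite muln_eq0; apply/orP; right.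
  rewrite cards_eq0; apply/eqP/setP => h; rewrite !inE.
  apply: contraNF ge => /and3P[/eqP bF hd hg].
  by move: hd; rewrite -mem_suffix_sorted (suffix_sorted_bottom bF hg Fd) => /andP[].
rewrite mul1n -(card_bottom_class fn cF).
set X := [set h | bottom_cards f h == F].
have dDF : [disjoint last_cards d :\: F & F].
  by rewrite -setI_eq0 setIDAC -setIDA setDv setI0.
have -> : #|X| = (f`! * q ^ f * #|[set h in X | same_pattern F h g]|)%N.
  rewrite -cF -card_supported; apply: card_pattern_class => c x cF'.
  by rewrite !inE (bottom_supported _ _ cF') //; left.
have -> : #|[set h in X | same_pattern F h g]|
    = ((d - e)`! * q ^ (d - e) * #|bottom_matching d f g F|)%N.
  have <- : #|last_cards d :\: F| = (d - e)%N.
    by rewrite cardsD setIC Fd !card_last_cards.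
  rewrite -card_supported [LHS](@card_pattern_class _ _ _ (last_cards d :\: F) 1%g); last first.
    move=> c x cD; rewrite !inE (bottom_supported _ _ cD); last by right.
    by rewrite (same_pattern_supported _ _ dDF cD).
  congr (_ * _)%N; apply: eq_card => h; rewrite !inE -mem_suffix_sorted.
  case: eqP => //= bF; case: (boolP (same_pattern F h g)) => hg; rewrite ?andbF //= andbT.
  by rewrite (suffix_sorted_bottom bF hg Fd) ge.
move: (_`! * _)%N (_`! * _)%N #|_| 'C(_, _) => D E B C.
by rewrite -!mulnA (mulnCA D).
Qed.

(** Such a set F is the union of the last e cards and of f - e cards chosen
    freely among the first n - d. *)
Lemma card_subset_trace d e f : (d <= n)%N -> (e <= d)%N -> (e <= f)%N ->
  #|[set F : {set 'I_n} | (#|F| == f) && (F :&: last_cards d == last_cards e)]|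
  = 'C(n - d, f - e).
Proof.
move=> dn ed ef; have en := leq_trans ed dn.
have sub := last_cards_sub ed.
have cC : #|~: last_cards d| = (n - d)%N.
  have := cardsC (last_cards d); rewrite card_ord card_last_cards // => /(congr1 (subn^~ d)).
  by rewrite addKn.
rewrite -cC -cards_draws.
have inj : {in [set B : {set 'I_n} | B \subset ~: last_cards d & #|B| == (f - e)%N] &,
    injective (fun B => last_cards e :|: B)}.
  move=> B B'; rewrite !inE => /andP[sB _] /andP[sB' _] /(congr1 (fun E => E :\: last_cards d)).
  rewrite !setDUl; have /eqP -> : last_cards e :\: last_cards d == set0 by rewrite setD_eq0.
  by rewrite !set0U !setDE (setIidPl sB) (setIidPl sB').
rewrite -(card_in_imset inj); apply: eq_card => F; rewrite inE; apply/andP/imsetP.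
  move=> [/eqP cF /eqP Fd]; exists (F :\: last_cards d); last by rewrite -Fd setID.
  rewrite inE setDE subsetIr /= -setDE cardsD Fd card_last_cards // cF //.
move=> [B]; rewrite inE => /andP[sB /eqP cB] ->; split.
  rewrite cardsU card_last_cards // cB (_ : _ :&: _ = set0) ?cards0 ?subn0 ?subnKC //.
  apply/eqP; rewrite setI_eq0; apply: disjointWl sub _.
  by rewrite disjoint_sym disjoints_subset.
rewrite setIUl (setIidPl sub).
have /eqP -> : B :&: last_cards d == set0 by rewrite setI_eq0 disjoints_subset.
by rewrite setU0.
Qed.

End SuffixClasses.

(** * The law after several shuffles *)

Section ShuffleLaw.
Import mathcomp.boot.fintype mathcomp.boot.finset.
Variables (R : realType) (n p : nat).
Local Notation G := (colored_perm n p).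
Local Notation q := p.-1.+1.
Local Notation choices := ({ffun 'I_n -> color p} * 'S_n * {set 'I_n})%type.
Implicit Types (F : {set 'I_n}) (g h : G) (d e f m : nat).

Lemma natr_fact_neq0 k : (k`!%:R : R) != 0.
Proof. by rewrite pnatr_eq0 -lt0n fact_gt0. Qed.

Lemma natr_card_neq0 : #|{: G}|%:R != 0 :> R.
Proof. by rewrite pnatr_eq0 -lt0n card_colored_perm muln_gt0 fact_gt0 expn_gt0. Qed.

Lemma unif_suffix_sorted e g : (e <= n)%N ->
  unif R (suffix_sorted n p e) g =
  (g \in suffix_sorted n p e)%:R * ((e`! * q ^ e)%:R / #|{: G}|%:R).
Proof.
move=> en; rewrite /unif; case: ifP => _; last by rewrite mul0r.
have := natr_card_neq0; rewrite (card_suffix_sorted p en) natrM mulf_eq0 negb_or => /andP[h1 h2].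
by rewrite mul1r invfM mulrA divff // mul1r.
Qed.

Lemma convolution_unif (A B : {set G}) g :
  convolution (unif R A) (unif R B) g =
  #|[set h in A | (h^-1 * g)%g \in B]|%:R / (#|A|%:R * #|B|%:R).
Proof.
rewrite /convolution /unif -sum1dep_card natr_sum mulr_suml big_mkcondl /= [RHS]big_mkcond /=.
apply: eq_bigr => h _; case: (h \in A); last by rewrite mul0r if_same.
by case: ifP => _; rewrite ?mulr0 // mul1r invfM.
Qed.

(** Splitting the decks h according to their bottom set F of f cards, only those F
    that meet the last d cards in the last e ones, for some e with g in V_e,
    contribute, and the contribution depends on e only.  The number of these F and
    the chance (d - e)!^-1 p^(e - d) that the remaining d - e cards are sorted combine
    into the hypergeometric weight. *)
Lemma convolution_suffix_sorted d f g : (d <= n)%N -> (f <= n)%N ->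
  convolution (unif R (suffix_sorted n p d)) (unif R (suffix_sorted n p f)) g =
  \sum_(e < f.+1) ('C(d, e) * 'C(n - d, f - e))%:R / 'C(n, f)%:R *
     unif R (suffix_sorted n p e) g.
Proof.
move=> dn fn; rewrite convolution_unif.
have C0 : 'C(n, f)%:R != 0 :> R by rewrite pnatr_eq0 -lt0n bin_gt0.
have q0 k : (q ^ k)%:R != 0 :> R by rewrite pnatr_eq0 -lt0n expn_gt0.
(* The common contribution of the bottom sets F with trace of size e. *)
pose blk e : R := ((g \in suffix_sorted n p e) * #|{: G}|)%:R /
  ('C(n, f) * ((d - e)`! * q ^ (d - e)) * (f`! * q ^ f))%:R.
have blkP F e : #|F| = f -> (e <= d)%N -> F :&: last_cards n d = last_cards n e ->
    #|bottom_matching d f g F|%:R = blk e.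
  move=> cF ed Fd; rewrite /blk -(card_bottom_matching _ dn fn ed cF Fd) natrM mulrAC divff ?mul1r //.
  by rewrite !natrM !mulf_neq0 ?natr_fact_neq0 ?q0.
have -> : #|[set h in suffix_sorted n p d | (h^-1 * g)%g \in suffix_sorted n p f]|
    = (\sum_(F : {set 'I_n} | #|F| == f) #|bottom_matching d f g F|)%N.
  rewrite -sum1_card (partition_big (bottom_cards f) (fun F : {set 'I_n} => #|F| == f)) /=; last first.
    by move=> h _; rewrite card_bottom.
  apply: eq_bigr => F _; rewrite sum1dep_card; apply: eq_card => h.
  rewrite !inE -!mem_suffix_sorted bottom_classP andbC.
  by case: eqP => //= ->.
have blk_sum F : #|F| = f -> #|bottom_matching d f g F|%:R =
    \sum_(e < f.+1) ((e <= d)%N && (F :&: last_cards n d == last_cards n e))%:R * blk e.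
  move=> cF; set k := #|F :&: last_cards n d|.
  have kf : (k < f.+1)%N by rewrite ltnS -cF subset_leq_card // subsetIl.
  have kd : (k <= d)%N by rewrite -[leqRHS](card_last_cards dn) subset_leq_card // subsetIr.
  rewrite (bigD1 (Ordinal kf)) //= big1 ?addr0 => [|e /eqP ne]; last first.
    case: (boolP (_ && _)) => [/andP[ed /eqP Fd]|]; last by rewrite mul0r.
    by case: ne; apply/val_inj => /=; rewrite /k Fd card_last_cards // (leq_trans ed).
  rewrite kd /=; case: eqP => [Fd|Fd]; first by rewrite mul1r; exact: blkP.
  rewrite mul0r; case: (set_0Vmem (bottom_matching d f g F)) => [->|[h hF]].
    by rewrite cards0.
  by case: Fd; exact: bottom_matching_suffix hF.
rewrite natr_sum; under eq_bigr => F /eqP cF do rewrite blk_sum //.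
rewrite exchange_big /= mulr_suml; apply: eq_bigr => e _.
have ef : (e <= f)%N by rewrite -ltnS.
rewrite -mulr_suml; case: (leqP e d) => ed /=; last first.
  by rewrite big1 ?mul0r // bin_small // mul0n !mul0r.
have en := leq_trans ed dn.
rewrite -natr_sum -big_mkcondr /= sum1dep_card card_subset_trace //.
rewrite unif_suffix_sorted // /blk natrM.
have cd := congr1 (fun k : nat => k%:R : R) (card_suffix_sorted p dn).
have cf := congr1 (fun k : nat => k%:R : R) (card_suffix_sorted p fn).
have G0 := natr_card_neq0.
have Vd : #|suffix_sorted n p d|%:R = #|{: G}|%:R / (d`! * q ^ d)%:R :> R.
  by rewrite cd natrM mulrAC divff ?mul1r // natrM mulf_neq0 ?natr_fact_neq0.
have Vf : #|suffix_sorted n p f|%:R = #|{: G}|%:R / (f`! * q ^ f)%:R :> R.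
  by rewrite cf natrM mulrAC divff ?mul1r // natrM mulf_neq0 ?natr_fact_neq0.
rewrite Vd Vf -(subnKC ed) expnD subnKC // -(bin_fact ed) !natrM.
have := G0; have := natr_fact_neq0 (d - e); have := natr_fact_neq0 f; have := natr_fact_neq0 e.
have := q0 e; have := q0 f; have := q0 (d - e)%N; have := C0.
move: (_ \in _)%:R => b; move: #|_|%:R => N.
move=> *; field.
do ![apply/andP; split=> //].
by rewrite pnatr_eq0 -lt0n bin_gt0.
Qed.

Lemma push_unif (T T' : finType) (S : {set T}) (X : T -> T') y :
  {in S &, injective X} -> push (unif R S) X y = unif R (X @: S) y.
Proof.
move=> inj; rewrite /push /unif card_in_imset //; case: imsetP => [[x xS ->]|nS].
  rewrite (bigD1 x) //= xS big1 ?addr0 // => z /andP[/eqP Xz zx].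
  by case: ifP => // zS; move: zx; rewrite (inj _ _ zS xS Xz) eqxx.
by rewrite big1 // => x /eqP Xx; case: ifP => // xS; case: nS; exists x.
Qed.

Lemma card_at_step (w : choices) i :
  card_at (step_of w) i = w.1.2 (insert_perm w.2 i).
Proof. by rewrite /step_of !card_at_mul /= perm1. Qed.

Lemma color_at_step (w : choices) i :
  color_at (step_of w) i = w.1.1 (w.1.2 (insert_perm w.2 i)).
Proof. by rewrite /step_of !color_at_mul /= !ffunE !addr0. Qed.

Lemma step_choicesP m (w : choices) :
  w \in step_choices n p m ->
  [/\ forall a, a \notin top_block n m -> w.1.1 a = 0,
      perm_on (top_block n m) w.1.2 & #|w.2| = m].
Proof.
case: w => -[c s] A; rewrite !inE /= => /andP[/andP[/forallP H sP] /eqP cA].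
by split=> // a /negPf am; have := H a; rewrite am => /eqP.
Qed.

(** The final positions of the removed cards are those that show a card of the
    top block; the permutation and the colors can then be read off. *)
Lemma step_of_inj m : {in step_choices n p m &, injective (@step_of n p)}.
Proof.
move=> w w' /step_choicesP[_ sT cA] /step_choicesP[_ sT' cA'] e.
have memA (v : choices) i : perm_on (top_block n m) v.1.2 -> #|v.2| = m ->
    (i \in v.2) = (card_at (step_of v : G) i \in top_block n m).
  by move=> vT cv; rewrite card_at_step perm_closed // inE -[in RHS]cv permE insert_ord_lt_card.
have eA : w.2 = w'.2 by apply/setP => i; rewrite !memA // e.
have es : w.1.2 = w'.1.2.
  apply/permP => i; have := card_at_step w ((insert_perm w.2)^-1 i)%g.
  rewrite e card_at_step -eA permKV => <- //.
case: w w' e eA es {memA sT sT' cA cA'} => -[c s] A [[c' s'] A'] /= e eA es.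
congr (_, _, _) => //; apply/ffunP => i.
have := color_at_step (c, s, A) ((insert_perm A)^-1 (s^-1 i))%g.
by rewrite e color_at_step /= -eA -es !permKV.
Qed.

(** The inserted cards all come from the top block, so the untouched cards keep
    their order and color 0. *)
Lemma step_suffix_sorted m w : (m <= n)%N -> w \in step_choices n p m ->
  step_of w \in suffix_sorted n p (n - m).
Proof.
move=> mn /step_choicesP[c0 sT cA]; rewrite mem_suffix_sorted.
have topE a : (a \in last_cards n (n - m)) = (a \notin top_block n m).
  by rewrite !inE subKn // leqNgt.
have posE a : a \in last_cards n (n - m) ->
    insert_perm w.2 (pos_of (step_of w) a) = a.
  rewrite topE => am; apply: (@perm_inj _ w.1.2).
  by rewrite -card_at_step pos_ofK (out_perm sT am).
have posN a : a \in last_cards n (n - m) -> pos_of (step_of w) a \notin w.2.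
  by move=> al; rewrite -insert_ord_lt_card -(permE (@insert_ord_inj _ _)) posE // cA; move: al; rewrite topE inE.
apply/same_patternP; split=> [a al|a b al bl].
  by rewrite color_of1 /color_of color_at_step posE // (out_perm sT) -?topE // c0 -?topE.
rewrite !pos_of1 -[in RHS](posE a al) -[in RHS](posE b bl) !permE insert_from_mono //.
by rewrite (negPf (posN a al)) (negPf (posN b bl)).
Qed.

Lemma card_step_choices m : (m <= n)%N ->
  #|step_choices n p m| = (q ^ m * m`! * 'C(n, m))%N.
Proof.
move=> mn; have ctop : #|top_block n m| = m.
  by rewrite -sum1dep_card -(big_ord_widen n (fun=> 1%N)) // sum1_card card_ord.
have card_color : #|{: color p}| = q by exact: card_ord.
rewrite !cardsX card_draws card_ord; congr (_ * _ * _)%N.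
  rewrite -[in RHS]ctop -card_color -(@card_pffun_on _ _ (0 : color p) (top_block n m) predT).
  apply: eq_card => c; rewrite inE; apply/forallP/pffun_onP => [H|[/subsetP H _] i].
    split=> //; apply/subsetP => i; rewrite inE.
    by have /orP[//|/eqP ->] := H i; rewrite eqxx.
  by case: (boolP (i \in _)) => //=; apply: contraNT => ci; apply: H; rewrite inE.
rewrite -[in RHS]ctop -card_perm; apply: eq_card => s; rewrite inE //.
Qed.

(** The choices of a step inject into the suffix class, and there are as many
    choices as elements of the class. *)
Lemma top_to_randomE m g : (m <= n)%N ->
  top_to_random R n p m g = unif R (suffix_sorted n p (n - m)) g.
Proof.
move=> mn; rewrite /top_to_random push_unif; last exact: step_of_inj.
congr (unif R _ g); apply/eqP; rewrite eqEcard; apply/andP; split.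
  by apply/subsetP => _ /imsetP[w wS ->]; exact: step_suffix_sorted.
rewrite card_in_imset ?card_step_choices //; last exact: step_of_inj.
have h := card_suffix_sorted p (leq_subr m n).
have k0 : (0 < (n - m)`! * q ^ (n - m))%N by rewrite muln_gt0 fact_gt0 expn_gt0.
have qn : (q ^ n = q ^ m * q ^ (n - m))%N by rewrite -expnD subnKC.
rewrite -(leq_pmul2l k0) -h card_colored_perm -(bin_fact mn) qn.
by apply: eq_leq; move: (q ^ _)%N (q ^ _)%N (_`!)%N (_`!)%N => *; rewrite -!mulnA; lia.
Qed.

(** The law of the number of untouched cards after k steps: one more step, which
    touches n - d uniformly chosen cards, keeps e of the f cards untouched so
    far with hypergeometric probability. *)
Fixpoint untouched_weight d k : nat -> R :=
  if k is k'.+1 then fun e =>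
    \sum_(f < n.+1 | (e <= f)%N)
       untouched_weight d k' f * (('C(d, e) * 'C(n - d, f - e))%:R / 'C(n, f)%:R)
  else fun e => (e == n)%:R.

Lemma suffix_sorted_all : suffix_sorted n p n = [set 1%g].
Proof.
apply/esym/eqP; rewrite eqEcard cards1; apply/andP; split.
  apply/subsetP => g; rewrite inE => /eqP ->; rewrite mem_suffix_sorted.
  by apply/same_patternP; split.
have := card_suffix_sorted p (leqnn n); rewrite card_colored_perm -[LHS]muln1 => /eqP.
by rewrite eqn_pmul2l ?muln_gt0 ?fact_gt0 ?expn_gt0 // => /eqP <-.
Qed.

Lemma convolution_powE m k g : (m <= n)%N ->
  convolution_pow (top_to_random R n p m) k g =
  \sum_(e < n.+1) untouched_weight (n - m) k e * unif R (suffix_sorted n p e) g.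
Proof.
move=> mn; have dn := leq_subr m n; elim: k g => [|k IH] g.
  rewrite big_ord_recr /= eqxx mul1r big1 ?add0r => [|e _]; last first.
    by rewrite (ltn_eqF (ltn_ord e)) mul0r.
  by rewrite /convolution_pow /= suffix_sorted_all.
rewrite /convolution_pow iterS -/(convolution_pow _ k) /convolution.
under eq_bigr => h _ do rewrite IH top_to_randomE // mulr_sumr.
rewrite exchange_big /=.
transitivity (\sum_(f < n.+1) \sum_(e < n.+1 | (e <= f)%N)
   untouched_weight (n - m) k f * (('C(n - m, e) * 'C(n - (n - m), f - e))%:R
     / 'C(n, f)%:R) * unif R (suffix_sorted n p e) g).
  apply: eq_bigr => f _; have fn : (f <= n)%N by rewrite -ltnS.
  rewrite -[RHS](big_ord_widen n.+1 (fun e => untouched_weight (n - m) k f *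
    (('C(n - m, e) * 'C(n - (n - m), f - e))%:R / 'C(n, f)%:R) *
    unif R (suffix_sorted n p e) g) (ltn_ord f)).
  under eq_bigr => h _ do rewrite mulrCA.
  rewrite -mulr_sumr -/(convolution (unif R (suffix_sorted n p (n - m)))
     (unif R (suffix_sorted n p f)) g) convolution_suffix_sorted // mulr_sumr.
  by apply: eq_bigr => e _; rewrite !mulrA.
rewrite (exchange_big_dep xpredT) //=; apply: eq_bigr => e _.
by rewrite mulr_suml.
Qed.

End ShuffleLaw.

(** * Binomial moments of the number of missed points *)

Section Moments.
Import mathcomp.boot.fintype mathcomp.boot.finset.
Variables (R : realType).
Implicit Types (n d e f t k m r : nat).

Lemma trinomial_revision f e t : (t <= e)%N ->
  ('C(f, e) * 'C(e, t) = 'C(f, t) * 'C(f - t, e - t))%N.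
Proof.
move=> te; case: (leqP e f) => ef; last first.
  rewrite bin_small // mul0n; case: (leqP t f) => tf; last by rewrite bin_small.
  by rewrite ['C(f - t, _)]bin_small ?muln0 //; lia.
have tf := leq_trans te ef.
have h1 := bin_fact ef; have h2 := bin_fact te; have h3 := bin_fact tf.
have := bin_fact (leq_sub2r t ef); rewrite subnBA // subnK // => h4.
have k0 : (0 < t`! * (e - t)`! * (f - e)`!)%N by rewrite !muln_gt0 !fact_gt0.
apply/eqP; rewrite -(eqn_pmul2r k0); apply/eqP.
transitivity f`!; first by rewrite -h1 -h2; lia.
by rewrite -h3 -h4; lia.
Qed.

(** After [trinomial_revision] pulls 'C(d, t) out of the sum, what remains is
    Vandermonde's identity. *)
Lemma hypergeometric_moment n d f t : (d <= n)%N -> (t <= f)%N ->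
  (\sum_(e < f.+1) 'C(d, e) * 'C(n - d, f - e) * 'C(e, t)
   = 'C(d, t) * 'C(n - t, f - t))%N.
Proof.
move=> dn tf.
have -> : (\sum_(e < f.+1) 'C(d, e) * 'C(n - d, f - e) * 'C(e, t) =
   \sum_(t <= e < f.+1) 'C(d, t) * ('C(d - t, e - t) * 'C(n - d, f - e)))%N.
  rewrite -(big_mkord xpredT (fun e => 'C(d, e) * 'C(n - d, f - e) * 'C(e, t))%N).
  rewrite (@big_cat_nat _ _ _ t) //= ?leqW // big_nat_cond big1 ?add0n; last first.
    by move=> e /andP[/andP[_ et] _]; rewrite ['C(e, t)]bin_small ?muln0.
  rewrite big_nat_cond [RHS]big_nat_cond; apply: eq_bigr => e /andP[/andP[te _] _].
  by rewrite mulnAC trinomial_revision // mulnA.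
rewrite -big_distrr /=; case: (leqP t d) => td; last by rewrite bin_small.
congr (_ * _)%N; rewrite -{1}[t]add0n big_addn big_mkord subSn //.
have -> : (n - t = d - t + (n - d))%N by lia.
rewrite -binomial.Vandermonde.
by apply: eq_bigr => e _; rewrite addnK addnC subnDA.
Qed.

(** One step multiplies the t-th binomial moment by the chance
    'C(d, t) / 'C(n, t) that t given cards all stay untouched, which does not
    depend on the past. *)
Lemma untouched_weight_moment n d k t : (d <= n)%N -> (t <= n)%N ->
  \sum_(e < n.+1) untouched_weight R n d k e * 'C(e, t)%:R
  = 'C(n, t)%:R * ('C(d, t)%:R / 'C(n, t)%:R) ^+ k.
Proof.
move=> dn tn; elim: k => [|k IH] /=.
  rewrite big_ord_recr /= eqxx mul1r expr0 mulr1 big1 ?add0r // => e _.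
  by rewrite (ltn_eqF (ltn_ord e)) mul0r.
rewrite exprSr mulrA -IH mulr_suml.
under eq_bigr => e _ do rewrite mulr_suml.
rewrite (exchange_big_dep xpredT) //=; apply: eq_bigr => f _.
have fn : (f <= n)%N by rewrite -ltnS.
transitivity (\sum_(e < f.+1) untouched_weight R n d k f *
    (('C(d, e) * 'C(n - d, f - e))%:R / 'C(n, f)%:R) * 'C(e, t)%:R).
  by rewrite (big_ord_widen n.+1 (fun e => untouched_weight R n d k f *
    (('C(d, e) * 'C(n - d, f - e))%:R / 'C(n, f)%:R) * 'C(e, t)%:R) (ltn_ord f)).
under eq_bigr => e _ do rewrite -mulrA [_ / _ * _]mulrAC -natrM [_ / 'C(n, f)%:R]mulrC mulrA.
rewrite -mulr_sumr -natr_sum -mulrA -[RHS]mulrA; congr (_ * _).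
have n0 : 'C(n, t)%:R != 0 :> R by rewrite pnatr_eq0 -lt0n bin_gt0.
have f0 : 'C(n, f)%:R != 0 :> R by rewrite pnatr_eq0 -lt0n bin_gt0.
case: (leqP t f) => tf; last first.
  rewrite ['C(f, t)]bin_small // mulr0n mul0r big1 ?mulr0 // => e _.
  by rewrite ['C(e, t)]bin_small ?muln0 // (leq_trans (ltn_ord e)).
rewrite hypergeometric_moment // natrM.
have /(congr1 (fun k : nat => k%:R : R)) := trinomial_revision n tf; rewrite !natrM => h.
have -> : 'C(n - t, f - t)%:R = 'C(n, f)%:R * 'C(f, t)%:R / 'C(n, t)%:R :> R.
  by rewrite h mulrAC divff // mul1r.
by field; rewrite n0 f0.
Qed.

(** The matrix of the binomial coefficients 'C(f, t) is inverted by that of the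
    (-1)^(t + e) 'C(t, e): the product is governed by the expansion of
    (1 - 1)^(f - e). *)
Lemma binomial_inversion n (w : nat -> R) e : (e <= n)%N ->
  w e = \sum_(t < n.+1) (-1) ^+ (t + e) * 'C(t, e)%:R *
          \sum_(f < n.+1) w f * 'C(f, t)%:R.
Proof.
move=> en; under eq_bigr => t _ do rewrite mulr_sumr.
rewrite exchange_big /= (bigD1 (inord e)) //= inordK ?ltnS //.
have key f : (f <= n)%N ->
    \sum_(t < n.+1) (-1) ^+ (t + e) * 'C(t, e)%:R * (w f * 'C(f, t)%:R) = (f == e)%:R * w f.
  move=> fn; under eq_bigr => t _ do rewrite mulrCA -mulrA -natrM mulnC.
  rewrite -mulr_sumr mulrC; congr (_ * _).
  rewrite -(big_mkord xpredT (fun t => (-1) ^+ (t + e) * ('C(f, t) * 'C(t, e))%:R)).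
  rewrite (@big_cat_nat _ _ _ e) //= ?leqW // big_nat_cond big1 ?add0r; last first.
    by move=> t /andP[/andP[_ te] _]; rewrite ['C(t, e)]bin_small ?muln0 ?mulr0.
  have -> : \sum_(e <= t < n.+1) (-1) ^+ (t + e) * ('C(f, t) * 'C(t, e))%:R =
     'C(f, e)%:R * \sum_(0 <= j < (n - e).+1) (-1) ^+ j * 'C(f - e, j)%:R :> R.
    rewrite -{1}[e]add0n big_addn subSn // mulr_sumr; apply: eq_bigr => j _.
    rewrite -addnA exprD addnn -mul2n exprM sqrrN !expr1n mulr1.
    by rewrite trinomial_revision ?leq_addl // addnK natrM mulrCA.
  case: (ltngtP f e) => [fe|ef|->]; first by rewrite bin_small // mul0r.
    rewrite (@big_cat_nat _ _ _ (f - e).+1) //= ?ltnS ?leq_sub2r //.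
    rewrite [X in _ + X]big_nat_cond [X in _ + X]big1 ?addr0; last first.
      by move=> j /andP[/andP[jf _] _]; rewrite bin_small ?mulr0.
    have := exprDn (1 : R) (-1) (f - e); rewrite subrr expr0n subn_eq0 leqNgt ef /=.
    rewrite big_mkord => h; rewrite (_ : \sum_(_ < _) _ = 0) ?mulr0 // [RHS]h.
    by apply: eq_bigr => j _; rewrite expr1n mul1r mulr_natr.
  rewrite binn mul1r subnn big_nat_recl // expr0 bin0 mulr1 big1 ?addr0 // => j _.
  by rewrite bin_small ?mulr0.
rewrite key // eqxx mul1r big1 ?addr0 // => f fe.
rewrite key -1?ltnS //; case: eqP => [fe'|]; last by rewrite mul0r.
by case/eqP: fe; apply: val_inj; rewrite /= inordK ?ltnS.
Qed.

Definition missed_pmf n m r e : R :=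
  \sum_(S : {ffun 'I_r -> {set 'I_n}} | num_missed S == e) indep_msubsets R n m r S.

Lemma missed_pmf_ge0 n m r e : 0 <= missed_pmf n m r e.
Proof.
apply: sumr_ge0 => S _; apply: prodr_ge0 => i _; rewrite /unif.
by case: ifP => // _; rewrite invr_ge0.
Qed.

Lemma num_missed_le n r (S : {ffun 'I_r -> {set 'I_n}}) : (num_missed S <= n)%N.
Proof. by rewrite -[leqRHS]card_ord max_card. Qed.

Lemma sum_num_missed n m r (phi : nat -> R) :
  \sum_(S : {ffun 'I_r -> {set 'I_n}}) indep_msubsets R n m r S * phi (num_missed S)
  = \sum_(e < n.+1) missed_pmf n m r e * phi e.
Proof.
rewrite (partition_big (fun S => inord (num_missed S) : 'I_n.+1) xpredT) //=.
apply: eq_bigr => e _; rewrite mulr_suml.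
have ee (S : {ffun 'I_r -> {set 'I_n}}) : (inord (num_missed S) == e :> 'I_n.+1) = (num_missed S == e :> nat).
  by rewrite -val_eqE /= inordK // ltnS num_missed_le.
by apply: eq_big => S; rewrite ee // => /eqP ->.
Qed.

(** 'C(E, t) counts the t-subsets K that are missed by all r sets; by
    independence each K is missed with probability ('C(n-m, t) / 'C(n, t))^r. *)
Lemma missed_pmf_moment n m r t : (m <= n)%N -> (t <= n)%N ->
  \sum_(e < n.+1) missed_pmf n m r e * 'C(e, t)%:R
  = 'C(n, t)%:R * ('C(n - m, t)%:R / 'C(n, t)%:R) ^+ r.
Proof.
move=> mn tn; rewrite -(sum_num_missed n m r (fun e => 'C(e, t)%:R)).
have subE (K : {set 'I_n}) (S : {ffun 'I_r -> {set 'I_n}}) :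
    (K \subset [set x | [forall i, x \notin S i]]) = [forall i, S i \subset ~: K].
  apply/subsetP/forallP => [H i|H x xK]; last first.
    rewrite inE; apply/forallP => i; have /subsetP/(_ x) := H i.
    by rewrite inE xK => /contraNN; apply.
  apply/subsetP => x xS; rewrite inE; apply/negP => /H; rewrite inE.
  by move=> /forallP/(_ i); rewrite xS.
have binE S : 'C(@num_missed n r S, t)%:R =
   \sum_(K : {set 'I_n} | #|K| == t) \prod_(i < r) (S i \subset ~: K)%:R :> R.
  rewrite /num_missed -cards_draws -sum1dep_card natr_sum [LHS]big_mkcondl /= big_mkcond [RHS]big_mkcond /=.
  apply: eq_bigr => K _; case: eqP => // _; rewrite subE.
  case: forallP => [H|/forallP]; first by rewrite big1 // => i _; rewrite H.
  by rewrite negb_forall => /existsP[i /negPf Hi]; rewrite (bigD1 i) //= Hi mul0r.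
under eq_bigr => S _ do rewrite binE mulr_sumr.
rewrite exchange_big /=.
have one (K : {set 'I_n}) : #|K| = t ->
    \sum_(A : {set 'I_n}) unif R (msubsets n m) A * (A \subset ~: K)%:R
    = 'C(n - m, t)%:R / 'C(n, t)%:R.
  move=> cK; have cC : #|~: K| = (n - t)%N.
    have := cardsC K; rewrite card_ord cK => /(congr1 (subn^~ t)).
    by rewrite addKn.
  transitivity ('C(n - t, m)%:R / 'C(n, m)%:R : R).
    rewrite -cC -cards_draws -sum1dep_card natr_sum mulr_suml [RHS]big_mkcond /=.
    apply: eq_bigr => A _; rewrite /unif inE card_draws card_ord.
    by case: (A \subset _); case: (#|A| == m); rewrite ?mulr0 ?mulr1 ?mul1r ?mul0r.
  have n0 : 'C(n, t)%:R != 0 :> R by rewrite pnatr_eq0 -lt0n bin_gt0.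
  have m0 : 'C(n, m)%:R != 0 :> R by rewrite pnatr_eq0 -lt0n bin_gt0.
  apply/eqP; rewrite eqr_div // -!natrM eqr_nat; apply/eqP.
  case: (leqP (m + t) n) => mtn; last first.
    by rewrite ['C(n - t, m)]bin_small ?['C(n - m, t)]bin_small //; lia.
  have h : ('C(n, n - t) * 'C(n - t, m) = 'C(n, m) * 'C(n - m, n - t - m))%N.
    by apply: trinomial_revision; lia.
  have h' : ('C(n - m, n - t - m) = 'C(n - m, t))%N.
    by rewrite subnAC bin_sub //; lia.
  by rewrite mulnC -(bin_sub tn) h h' mulnC.
under eq_bigr => K /eqP cK.
  rewrite /indep_msubsets; under eq_bigr => S _ do rewrite -big_split /=.
  rewrite -(bigA_distr_bigA (fun (i : 'I_r) A => unif R (msubsets n m) A * (A \subset ~: K)%:R)).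
  rewrite /=; under eq_bigr => i _ do rewrite (one K cK).
  rewrite prodr_const card_ord; over.
have -> : 'C(n, t) = (\sum_(K : {set 'I_n} | #|K| == t) 1)%N.
  by rewrite sum1dep_card card_draws card_ord.
by rewrite natr_sum mulr_suml; apply: eq_bigr => K _; rewrite mul1r.
Qed.

(** Both sides have the same binomial moments, and these determine a weight
    function on {0,...,n}. *)
Lemma untouched_weightE n m r e : (m <= n)%N -> (e <= n)%N ->
  untouched_weight R n (n - m) r e = missed_pmf n m r e.
Proof.
move=> mn en; rewrite (binomial_inversion (untouched_weight R n (n - m) r) en).
rewrite [RHS](binomial_inversion _ en); apply: eq_bigr => t _; congr (_ * _).
have tn : (t <= n)%N by rewrite -ltnS.
by rewrite missed_pmf_moment // untouched_weight_moment // leq_subr.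
Qed.

End Moments.

(** * Limits of sums and of binomial moments *)

Section Analysis.
Local Open Scope classical_set_scope.
Variable R : realType.
Implicit Types (u : nat -> nat -> R) (b v : nat -> R).

Lemma cvgn_near_eq (f g : nat -> R) (l : R) :
  (\forall n \near \oo, f n = g n) -> g n @[n --> \oo] --> l -> f n @[n --> \oo] --> l.
Proof.
move=> fg /cvgrPdist_le gl; apply/cvgrPdist_le => e e0.
by apply: filterS2 fg (gl e e0) => n ->.
Qed.

Lemma cvgn_sum (F : nat -> nat -> R) (l : nat -> R) N :
  (forall k, F n k @[n --> \oo] --> l k) ->
  \sum_(k < N) F n k @[n --> \oo] --> \sum_(k < N) l k.
Proof.
move=> Fl; elim: N => [|N IH].
  rewrite big_ord0; under eq_fun do rewrite big_ord0; exact: cvg_cst.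
rewrite big_ord_recr /=; under eq_fun do rewrite big_ord_recr /=; exact: cvgD.
Qed.

Lemma cvgn_prod (F : nat -> nat -> R) (l : nat -> R) N :
  (forall k, F n k @[n --> \oo] --> l k) ->
  \prod_(k < N) F n k @[n --> \oo] --> \prod_(k < N) l k.
Proof.
move=> Fl; elim: N => [|N IH].
  rewrite big_ord0; under eq_fun do rewrite big_ord0; exact: cvg_cst.
rewrite big_ord_recr /=; under eq_fun do rewrite big_ord_recr /=; exact: cvgM.
Qed.

Lemma cvgn_expr (F : nat -> R) (l : R) N :
  F n @[n --> \oo] --> l -> F n ^+ N @[n --> \oo] --> l ^+ N.
Proof.
move=> Fl; have := @cvgn_prod (fun n _ => F n) (fun _ => l) N (fun _ => Fl).
by rewrite prodr_const card_ord; under eq_fun do rewrite prodr_const card_ord.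
Qed.

Lemma cvgn_max0 (F : nat -> R) (l : R) :
  F n @[n --> \oo] --> l -> Num.max (F n) 0 @[n --> \oo] --> Num.max l 0.
Proof.
move=> Fl; rewrite maxr_absE; under eq_fun do rewrite maxr_absE.
rewrite !subr0 !addr0; under eq_fun do rewrite subr0 addr0.
apply: cvgM; last exact: cvg_cst.
by apply: cvgD => //; exact: cvg_norm.
Qed.

(** Tannery's theorem, dominated convergence for series, with the finite
    truncation of the series growing with n. *)
Lemma tannery u v b : cvgn (series b) ->
  (forall k, u n k @[n --> \oo] --> v k) ->
  (\forall n \near \oo, forall k, `|u n k| <= b k) ->
  \sum_(k < n.+1) u n k @[n --> \oo] --> limn (series v).
Proof.
move=> cb uv ub.
have vb k : `|v k| <= b k.
  have h : `|u n k| @[n --> \oo] --> `|v k| by exact: cvg_norm.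
  rewrite -(cvg_lim _ h) //; apply: limr_le; first by apply/cvg_ex; exists `|v k|.
  by apply: filterS ub => n; exact.
have b0 k : 0 <= b k := le_trans (normr_ge0 _) (vb k).
have bmono : nondecreasing_seq (series b) by exact: nondecreasing_series.
have tail (w : nat -> R) K N : (forall k, `|w k| <= b k) -> (K <= N)%N ->
    `|series w N - series w K| <= limn (series b) - series b K.
  move=> wb KN; rewrite sub_series_geq //; apply: le_trans (ler_norm_sum _ _ _) _.
  apply: (@le_trans _ _ (series b N - series b K)).
    by rewrite sub_series_geq //; apply: ler_sum.
  by rewrite lerD2r; exact: nondecreasing_cvgn_le.
have cv : cvgn (series v).
  apply: normed_cvg; exact: (series_le_cvg (fun n => normr_ge0 (v n)) b0 vb cb).
apply/cvgrPdist_le => e e0.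
have e30 : 0 < e / 3 by rewrite divr_gt0.
have /cvgrPdist_le/(_ _ e30)[K _ bK] : series b n @[n --> \oo] --> limn (series b) by exact: cb.
have tailK (w : nat -> R) N : (forall k, `|w k| <= b k) -> (K <= N)%N ->
    `|series w N - series w K| <= e / 3.
  move=> wb KN; apply: le_trans (tail w K N wb KN) _.
  by apply: le_trans (bK K (leqnn _)); exact: ler_norm.
(* The three errors: the tail of v, the tail of u n, and the first K terms. *)
have vK : `|limn (series v) - series v K| <= e / 3.
  have h : `|series v N - series v K| @[N --> \oo] --> `|limn (series v) - series v K|.
    by apply: cvg_norm; apply: cvgB => //; exact: cvg_cst.
  rewrite -(cvg_lim _ h) //; apply: limr_le; first by apply/cvg_ex; eexists; exact: h.
  near=> N; apply: tailK => //; near: N; exact: nbhs_infty_ge.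
have uK : series (u n) K @[n --> \oo] --> series v K.
  rewrite seriesEord /=; under eq_fun do rewrite seriesEord /=.
  exact: cvgn_sum.
near=> n.
have -> : \sum_(k < n.+1) u n k = series (u n) n.+1 by rewrite seriesEord.
have un : `|series v K - series (u n) K| <= e / 3.
  by near: n; move/cvgrPdist_le: uK; apply.
have ubn : forall k, `|u n k| <= b k by near: n.
have Kn : (K <= n.+1)%N by apply: leqW; near: n; exact: nbhs_infty_ge.
have := tailK (u n) n.+1 ubn Kn.
move: vK un; rewrite !ler_norml => /andP[? ?] /andP[? ?] /andP[? ?]; apply/andP; split; lra.
Unshelve. all: by end_near.
Qed.

Lemma bin_prod n k :
  'C(n, k)%:R = \prod_(i < k) (n%:R - i%:R) / k`!%:R :> R.
Proof.
elim: k => [|k IH]; first by rewrite big_ord0 bin0 fact0 divr1.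
have k1 : k.+1%:R != 0 :> R by rewrite pnatr_eq0.
apply: (mulfI k1); rewrite -natrM mul_bin_left natrM IH big_ord_recr /= factS natrM invfM.
rewrite (_ : (n - k)%:R * (\prod_(i < k) (n%:R - i%:R) / k`!%:R) =
   (n%:R - k%:R) * (\prod_(i < k) (n%:R - i%:R) / k`!%:R)); last first.
  by case: (leqP k n) => kn; [rewrite natrB|rewrite -IH bin_small ?mulr0n ?mulr0].
have := @natr_fact_neq0 R k; move: k1; move: k.+1%:R k`!%:R => y z y0 z0.
by field; rewrite y0 z0.
Qed.

Definition missed_moment n m r t : R :=
  'C(n, t)%:R * ('C(n - m, t)%:R / 'C(n, t)%:R) ^+ r.

(** The i-th of the t factors into which t! times the t-th moment splits; each of
    them has the limit a^r, which is why the limiting moments are Poisson. *)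
Definition moment_factor n m r i : R :=
  (n%:R - i%:R) * ((n%:R - m%:R - i%:R) / (n%:R - i%:R)) ^+ r.

Lemma missed_moment_prod n m r t : (m <= n)%N ->
  missed_moment n m r t = t`!%:R^-1 * \prod_(i < t) moment_factor n m r i.
Proof.
move=> mn; rewrite /missed_moment big_split /= prodrXl prodf_div -natrB // !bin_prod.
have t0 := @natr_fact_neq0 R t.
rewrite mulrCA mulrA; congr (_ * _ ^+ r).
by rewrite invfM invrK mulrACA mulVf // mulr1.
Qed.

Lemma missed_moment_ge0 n m r t : 0 <= missed_moment n m r t.
Proof. by rewrite mulr_ge0 // exprn_ge0 // divr_ge0. Qed.

(** All factors are at most the first one, as (d - i) / (n - i) <= d / n for
    d = n - m; and the moment vanishes when t > d. *)
Lemma missed_moment_le n m r t B : (0 < r)%N -> (m <= n)%N ->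
  moment_factor n m r 0 <= B -> missed_moment n m r t <= B ^+ t / t`!%:R.
Proof.
move=> r0 mn fB; have f0 : 0 <= moment_factor n m r 0.
  by rewrite /moment_factor !subr0 mulr_ge0 ?exprn_ge0 ?divr_ge0 ?subr_ge0 ?ler_nat.
have B0 := le_trans f0 fB.
case: (leqP t (n - m)) => tnm; last first.
  rewrite /missed_moment (@bin_small (n - m)) // mul0r expr0n eqn0Ngt r0 mulr0.
  by rewrite divr_ge0 ?exprn_ge0.
rewrite missed_moment_prod // mulrC ler_pM2r ?invr_gt0 ?ltr0n ?fact_gt0 //.
rewrite -[X in B ^+ X]card_ord -prodr_const; apply: ler_prod => i _.
have im : (i < n - m)%N := leq_trans (ltn_ord i) tnm.
have i_n : (i < n)%N := leq_trans im (leq_subr _ _).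
have di0 : 0 <= n%:R - m%:R - i%:R :> R by rewrite -natrB // subr_ge0 ler_nat ltnW.
have ni0 : 0 < n%:R - i%:R :> R by rewrite subr_gt0 ltr_nat.
have n0 : 0 < n%:R :> R by rewrite ltr0n (leq_trans _ i_n).
rewrite /moment_factor mulr_ge0 ?(ltW ni0) ?exprn_ge0 ?divr_ge0 ?(ltW ni0) //=.
apply: le_trans fB; rewrite /moment_factor !subr0.
apply: ler_pM; rewrite ?(ltW ni0) ?exprn_ge0 ?divr_ge0 ?(ltW ni0) //.
  by rewrite gerBl.
rewrite ler_pXn2r ?nnegrE ?divr_ge0 ?(ltW ni0) ?subr_ge0 ?ler_nat //; last first.
  by rewrite -subr_ge0.
rewrite ler_pdivrMr // mulrAC ler_pdivlMr //.
have : 0 <= i%:R * m%:R :> R by rewrite mulr_ge0.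
by move: (i%:R) (m%:R) (n%:R) => x y z; lra.
Qed.

(** With y = n^(1 - 1/r), so that y^r = n^(r-1), the factor equals
    ((d - i) / y)^r (n / (n - i))^(r-1) where d = n - m n, and d / y tends to
    a while y tends to infinity. *)
Lemma moment_factor_cvg r (a : R) (m : nat -> nat) i : (2 <= r)%N -> 0 < a ->
  asym_equiv (fun n : nat => n%:R - (m n)%:R)
             (fun n : nat => a * n%:R `^ (1 - r%:R^-1)) ->
  moment_factor n (m n) r i @[n --> \oo] --> a ^+ r.
Proof.
move=> hr ha hasym.
have r0 : r%:R != 0 :> R by rewrite pnatr_eq0; case: r hr {hasym}.
pose y n : R := n%:R `^ (1 - r%:R^-1).
have yr n : y n ^+ r = n%:R ^+ r.-1.
  rewrite -powR_mulrn ?powR_ge0 // -powRrM mulrBl mul1r mulVf //.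
  by rewrite -[1]/(1%:R) -natrB ?(ltnW hr) // subn1 powR_mulrn.
have ygt0 n : (0 < n)%N -> 0 < y n by move=> n0; rewrite powR_gt0 // ltr0n.
have yoo : y n @[n --> \oo] --> +oo.
  apply/cvgryPge => A; near=> n.
  have n0 : (0 < n)%N by near: n; exact: nbhs_infty_ge.
  have nA : `|A| ^+ r <= n%:R by near: n; exact: nbhs_infty_ger.
  apply: le_trans (ler_norm A) _.
  rewrite -(@ler_pXn2r _ r) ?nnegrE ?(ltW (ygt0 n n0)) ?(ltnW hr) // yr.
  apply: le_trans nA _; rewrite -[leLHS]expr1 ler_weXn2l ?ler1n //.
  by rewrite -ltnS prednK ?(ltnW hr).
have y0 : (y n)^-1 @[n --> \oo] --> (0 : R).
  by apply/gtr0_cvgV0 => //; near=> n; apply: ygt0; near: n; exact: nbhs_infty_ge.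
have n0 : (n%:R : R)^-1 @[n --> \oo] --> (0 : R).
  apply/gtr0_cvgV0; first by near=> n; rewrite ltr0n; near: n; exact: nbhs_infty_ge.
  by apply/cvgryPge => A; exact: nbhs_infty_ger.
have zl : (n%:R - (m n)%:R) / (a * y n) * a - i%:R * (y n)^-1 @[n --> \oo] --> a.
  suff : (n%:R - (m n)%:R) / (a * y n) * a - i%:R * (y n)^-1 @[n --> \oo]
      --> 1 * a - i%:R * 0 by rewrite mul1r mulr0 subr0.
  apply: cvgB; first by apply: cvgM; [exact: hasym|exact: cvg_cst].
  by apply: cvgM => //; exact: cvg_cst.
have wl : (1 - i%:R * (n%:R : R)^-1)^-1 @[n --> \oo] --> (1 : R).
  rewrite -[X in _ --> X]invr1; apply: cvgV; first exact: oner_neq0.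
  suff : 1 - i%:R * (n%:R : R)^-1 @[n --> \oo] --> (1 - i%:R * 0 : R).
    by rewrite mulr0 subr0.
  by apply: cvgB; [exact: cvg_cst|apply: cvgM => //; exact: cvg_cst].
have h : ((n%:R - (m n)%:R) / (a * y n) * a - i%:R * (y n)^-1) ^+ r *
    (1 - i%:R * (n%:R : R)^-1)^-1 ^+ r.-1 @[n --> \oo] --> a ^+ r.
  have -> : a ^+ r = a ^+ r * 1 ^+ r.-1 by rewrite expr1n mulr1.
  by apply: cvgM; apply: cvgn_expr.
apply: cvgn_near_eq h; near=> n.
have ngt : (i < n)%N by near: n; exact: nbhs_infty_gt.
have nr0 : n%:R != 0 :> R by rewrite pnatr_eq0 -lt0n (leq_ltn_trans _ ngt).
have ni0 : n%:R - i%:R != 0 :> R by rewrite subr_eq0 eqr_nat gtn_eqF.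
have yn0 : y n != 0 by rewrite gt_eqF // ygt0 // (leq_ltn_trans _ ngt).
rewrite /= /moment_factor; move: (m n)%:R (yr n) => d.
have -> : (n%:R - d) / (a * y n) * a - i%:R / y n = (n%:R - d - i%:R) / y n.
  by field; rewrite yn0 gt_eqF.
have -> : (1 - i%:R / n%:R)^-1 = n%:R / (n%:R - i%:R) :> R by field; rewrite nr0 ni0.
rewrite !expr_div_n => ->.
have -> : (n%:R - i%:R) ^+ r = (n%:R - i%:R) * (n%:R - i%:R) ^+ r.-1 :> R.
  by rewrite -exprS prednK // (ltnW hr).
have := expf_neq0 r.-1 ni0; have := expf_neq0 r.-1 nr0.
move: (_ ^+ r.-1) (_ ^+ r.-1) (_ ^+ r) => s t w s0 t0.
by field; rewrite ?s0 ?t0 ?ni0.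
Unshelve. all: by end_near.
Qed.

End Analysis.

(** * The Poisson limit *)

Section PoissonLimit.
Local Open Scope classical_set_scope.
Variables (R : realType) (r : nat) (a : R) (m : nat -> nat).

Lemma missed_pmf_gt n k s e : (n < e)%N -> missed_pmf R n k s e = 0.
Proof.
move=> ne; apply: big1 => S /eqP Se.
by have := num_missed_le S; rewrite Se leqNgt ne.
Qed.

(** The term f = e of the e-th binomial moment is already the left-hand side. *)
Lemma missed_pmf_le_moment n k s e : (k <= n)%N ->
  missed_pmf R n k s e <= missed_moment R n k s e.
Proof.
move=> kn; case: (leqP e n) => en; last by rewrite missed_pmf_gt ?missed_moment_ge0.
rewrite /missed_moment -missed_pmf_moment // (bigD1 (inord e)) //= inordK ?ltnS // binn mulr1.
by rewrite lerDl sumr_ge0 // => f _; rewrite mulr_ge0 ?missed_pmf_ge0.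
Qed.

Hypothesis r2 : (2 <= r)%N.
Hypothesis a0 : 0 < a.
Hypothesis mP : forall n : nat, (2 <= n)%N -> (1 <= m n <= n - 1)%N.
Hypothesis masym : asym_equiv (fun n : nat => n%:R - (m n)%:R)
                              (fun n : nat => a * n%:R `^ (1 - r%:R^-1)).

Lemma near_sizes : \forall n \near \oo, (2 <= n)%N /\ (m n <= n)%N.
Proof.
near=> n; have n2 : (2 <= n)%N by near: n; exact: nbhs_infty_ge.
by split=> //; have /andP[_ /leq_trans->] := mP n2; rewrite ?leq_subr.
Unshelve. all: by end_near.
Qed.

(** The domination, uniform in n, that feeds both uses of [tannery]. *)
Lemma near_moment_le : \forall n \near \oo, forall t,
  missed_moment R n (m n) r t <= (a ^+ r + 1) ^+ t / t`!%:R.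
Proof.
have := @moment_factor_cvg R r a m 0 r2 a0 masym.
move=> /cvgr_le/(_ (a ^+ r + 1)); rewrite ltrDl ltr01 => /(_ isT) h.
near=> n => t; apply: missed_moment_le; first by rewrite ltnW.
  by have [] : (2 <= n)%N /\ (m n <= n)%N by near: n; exact: near_sizes.
by near: n.
Unshelve. all: by end_near.
Qed.

Lemma missed_moment_cvg t :
  missed_moment R n (m n) r t @[n --> \oo] --> (a ^+ r) ^+ t / t`!%:R.
Proof.
apply: (@cvgn_near_eq _ _ (fun n => t`!%:R^-1 * \prod_(i < t) moment_factor R n (m n) r i)).
  by apply: filterS near_sizes => n [_ mn]; exact: missed_moment_prod.
rewrite mulrC; apply: cvgM; first exact: cvg_cst.
rewrite -[X in _ ^+ X]card_ord -prodr_const.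
apply: (@cvgn_prod _ (fun n i => moment_factor R n (m n) r i) (fun=> a ^+ r)) => i.
exact: moment_factor_cvg.
Qed.

(** Poisson moments are inverted to the Poisson law: shifting the index by e
    leaves the exponential series of - l. *)
Lemma series_alternating_poisson (l : R) e :
  series (fun t => (-1) ^+ (t + e) * 'C(t, e)%:R * (l ^+ t / t`!%:R)) n @[n --> \oo]
  --> l ^+ e / e`!%:R * expR (- l).
Proof.
rewrite -(cvg_shiftn e).
have -> : [sequence series (fun t => (-1) ^+ (t + e) * 'C(t, e)%:R * (l ^+ t / t`!%:R)) (n + e)%N]_n
   = (fun n => l ^+ e / e`!%:R * series (exp_coeff (- l)) n).
  apply/funext => n /=; rewrite /series /= addnC (@big_cat_nat _ _ _ e) ?leq_addr //=.
  rewrite big_nat_cond big1 ?add0r => [|t /andP[/andP[_ te] _]]; last first.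
    by rewrite bin_small // mulr0 mul0r.
  rewrite -{1}[e]add0n big_addn addKn mulr_sumr; apply: eq_bigr => j _.
  rewrite -addnA addnn exprD -mul2n exprM sqrrN !expr1n mulr1 /exp_coeff /= (exprNn l) exprD.
  have /(congr1 (fun k : nat => k%:R : R)) := bin_fact (leq_addl j e).
  rewrite addnK !natrM => <-.
  have := @natr_fact_neq0 R j; have := @natr_fact_neq0 R e.
  have : 'C(j + e, e)%:R != 0 :> R by rewrite pnatr_eq0 -lt0n bin_gt0 leq_addl.
  move: ('C(_, _)%:R) (e`!%:R) (j`!%:R) => x y z x0 y0 z0.
  by field; rewrite x0 y0 z0.
by apply: cvgM; [exact: cvg_cst|exact: is_cvg_series_exp_coeff].
Qed.

Lemma bin_le_expn t e : ('C(t, e) <= 2 ^ t)%N.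
Proof.
elim: t e => [|t IH] [|e] //; first by rewrite bin0 expn_gt0.
by rewrite binS expnS mul2n -addnn leq_add.
Qed.

(** [tannery] applied to [binomial_inversion]; the factor 'C(t, e) <= 2^t is
    absorbed in the dominating exponential series. *)
Lemma missed_pmf_cvg e :
  missed_pmf R n (m n) r e @[n --> \oo] --> (a ^+ r) ^+ e / e`!%:R * expR (- a ^+ r).
Proof.
pose b := exp_coeff (2 * (a ^+ r + 1)) : nat -> R.
pose v t : R := (-1) ^+ (t + e) * 'C(t, e)%:R * ((a ^+ r) ^+ t / t`!%:R).
have vl := @series_alternating_poisson (a ^+ r) e.
rewrite -(cvg_lim _ vl) //.
apply: (@cvgn_near_eq _ _ (fun n => \sum_(t < n.+1)
   (-1) ^+ (t + e) * 'C(t, e)%:R * missed_moment R n (m n) r t)).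
  near=> n; have [_ mn] : (2 <= n)%N /\ (m n <= n)%N by near: n; exact: near_sizes.
  have en : (e <= n)%N by near: n; exact: nbhs_infty_ge.
  rewrite (binomial_inversion (missed_pmf R n (m n) r) en); apply: eq_bigr => t _.
  by congr (_ * _); apply: missed_pmf_moment => //; rewrite -ltnS.
apply: (@tannery _ (fun n t => (-1) ^+ (t + e) * 'C(t, e)%:R * missed_moment R n (m n) r t)
   _ b); first exact: is_cvg_series_exp_coeff.
  by move=> t; apply: cvgM; [exact: cvg_cst|exact: missed_moment_cvg].
apply: filterS near_moment_le => n h t.
rewrite normrM (ger0_norm (missed_moment_ge0 _ _ _ _ _)) normrM normrX normrN1 expr1n mul1r normr_nat.
rewrite /b /exp_coeff /= exprMn -mulrA; apply: ler_pM => //.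
  exact: missed_moment_ge0.
by rewrite -natrX ler_nat bin_le_expn.
Unshelve. all: by end_near.
Qed.

Lemma natr_le_threshold (x : R) : exists N, forall k : nat, (k%:R <= x) = (k < N)%N.
Proof.
case: (lerP 0 x) => x0; last first.
  exists 0 => k; rewrite ltn0; apply/negbTE; rewrite -ltNge.
  exact: lt_le_trans x0 _.
by exists (Num.truncn x).+1 => k; rewrite ltnS truncn_ge_nat.
Qed.

Lemma missed_cdfE n k s (x : R) N : (forall j : nat, (j%:R <= x) = (j < N)%N) ->
  (N <= n.+1)%N -> missed_cdf R n k s x = \sum_(e < N) missed_pmf R n k s e.
Proof.
move=> xN Nn; rewrite /missed_cdf /cdf_fin.
transitivity (\sum_(S : {ffun 'I_s -> {set 'I_n}})
   indep_msubsets R n k s S * (num_missed S < N)%:R).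
  rewrite big_mkcond /=; apply: eq_bigr => S _.
  by rewrite xN; case: ltnP; rewrite ?mulr1 ?mulr0.
rewrite (sum_num_missed n k s (fun e => (e < N)%:R)).
rewrite (big_ord_widen n.+1 (missed_pmf R n k s) Nn) [RHS]big_mkcond /=.
by apply: eq_bigr => e _; case: ltnP; rewrite ?mulr1 ?mulr0.
Qed.

Lemma poisson_cdfE (l x : R) N : 0 < l -> (forall j : nat, (j%:R <= x) = (j < N)%N) ->
  poisson_cdf l x = \sum_(e < N) l ^+ e / e`!%:R * expR (- l).
Proof.
move=> l0 xN; rewrite /poisson_cdf /poisson_prob l0.
have -> : [set k : nat | k%:R <= x] = `I_N.
  by apply/seteqP; split => k /=; rewrite xN.
rewrite esum_fset //; last by move=> k _; rewrite lee_fin poisson_pmf_ge0.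
rewrite -fsbig_ord sumEFin /=; apply: eq_bigr => e _.
by rewrite /poisson_pmf l0.
Qed.

Lemma missed_cdf_cvg (x : R) :
  missed_cdf R n (m n) r x @[n --> \oo] --> poisson_cdf (a ^+ r) x.
Proof.
have [N xN] := natr_le_threshold x.
rewrite (poisson_cdfE _ xN) ?exprn_gt0 //.
apply: (@cvgn_near_eq _ _ (fun n => \sum_(e < N) missed_pmf R n (m n) r e)).
  near=> n; apply: missed_cdfE => //; apply: leqW; near: n; exact: nbhs_infty_ge.
apply: (@cvgn_sum _ (fun n e => missed_pmf R n (m n) r e)
  (fun e => (a ^+ r) ^+ e / e`!%:R * expR (- a ^+ r))) => e.
exact: missed_pmf_cvg.
Unshelve. all: by end_near.
Qed.

End PoissonLimit.

(** * Total variation and separation of a mixture *)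

Section Distances.
Import mathcomp.boot.fintype mathcomp.boot.finset.
Variables (R : realType) (n p : nat).
Hypothesis p0 : (0 < p)%N.
Local Notation G := (colored_perm n p).
Local Notation V := (suffix_sorted n p).
Implicit Types (g : G) (e l : nat) (w phi : nat -> R).

Lemma unif_suffix_sortedE e g : (e <= n)%N ->
  unif R (V e) g = (g \in V e)%:R * ((e`! * p ^ e)%:R / #|{: G}|%:R).
Proof. by move=> en; rewrite unif_suffix_sorted // prednK. Qed.

Lemma suffix_sorted_prob e : (e <= n)%N ->
  #|V e|%:R / #|{: G}|%:R = (e`!%:R * p%:R ^+ e)^-1 :> R.
Proof.
move=> en; have := natr_card_neq0 R n p; rewrite (card_suffix_sorted p en) prednK //.
rewrite !natrM natrX !mulf_eq0 !negb_or => /andP[/andP[e0 pe0] V0].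
by field; rewrite e0 pe0 V0.
Qed.

Definition suffix_length g : nat := \max_(e < n.+1 | g \in V e) e.

Lemma suffix_length_lt g : (suffix_length g < n.+1)%N.
Proof. by rewrite ltnS; apply/bigmax_leqP => e _; rewrite -ltnS. Qed.

Lemma leq_suffix_length e g : (e <= n)%N -> (e <= suffix_length g)%N = (g \in V e).
Proof.
move=> en; apply/idP/idP => [|ge]; last first.
  have en1 : (e < n.+1)%N by rewrite ltnS.
  exact: (@leq_bigmax_cond _ (fun k : 'I_n.+1 => g \in V k) (fun k => k : nat) (Ordinal en1)).
have V0 : g \in V (@ord0 n).
  rewrite mem_suffix_sorted; apply/same_patternP; have no (a : 'I_n) : a \notin last_cards n 0.
    by rewrite inE subn0 -ltnNge.
  by split=> [b|b c] => /[dup] h; rewrite (negPf (no _)).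
have /(eq_bigmax_cond (fun k : 'I_n.+1 => k : nat)) [k kV kE] : (0 < #|[pred k : 'I_n.+1 | g \in V k]|)%N.
  by apply/card_gt0P; exists ord0; rewrite inE.
rewrite /suffix_length kE => ek.
by apply: (subsetP (suffix_sorted_sub n p ek)); rewrite inE in kV.
Qed.

(** For l = n there is no longer suffix to exclude, hence the boundary case. *)
Definition level_prob l : R := (l`!%:R * p%:R ^+ l)^-1 -
  (if (l < n)%N then (l.+1`!%:R * p%:R ^+ l.+1)^-1 else 0).

Lemma card_level l : (l <= n)%N ->
  #|[set g | suffix_length g == l]|%:R / #|{: G}|%:R = level_prob l.
Proof.
move=> ln; rewrite /level_prob; case: ltnP => nl.
  have -> : [set g | suffix_length g == l] = V l :\: V l.+1.
    apply/setP => g; rewrite in_setD -!leq_suffix_length // inE -leqNgt eq_sym eqn_leq andbC //.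
  rewrite cardsD (setIidPr (suffix_sorted_sub n p (leqnSn l))).
  rewrite natrB ?subset_leq_card ?suffix_sorted_sub // mulrBl !suffix_sorted_prob //.
have {nl ln} -> : l = n by apply/eqP; rewrite eqn_leq ln.
rewrite subr0 -suffix_sorted_prob //; congr (_%:R / _); apply: eq_card => g.
by rewrite -leq_suffix_length // inE eqn_leq -ltnS suffix_length_lt.
Qed.

Lemma sum_suffix_length phi :
  \sum_g #|{: G}|%:R^-1 * phi (suffix_length g) = \sum_(l < n.+1) level_prob l * phi l.
Proof.
rewrite (partition_big (fun g => Ordinal (suffix_length_lt g)) xpredT) //=.
apply: eq_bigr => l _; rewrite -card_level; last by rewrite -ltnS.
rewrite -mulrA -sum1dep_card natr_sum mulr_suml.
apply: eq_big => [g|g /eqP lE]; last by rewrite -lE mul1r.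
by rewrite -val_eqE.
Qed.

Definition suffix_mixture w g : R := \sum_(e < n.+1) w e * unif R (V e) g.

(** The density, with respect to the uniform law, at decks of suffix length l. *)
Definition density w l : R := \sum_(e < l.+1) w e * (e`!%:R * p%:R ^+ e).

Lemma suffix_mixtureE w g :
  suffix_mixture w g = #|{: G}|%:R^-1 * density w (suffix_length g).
Proof.
rewrite /density (big_ord_widen n.+1 (fun e => w e * (e`!%:R * p%:R ^+ e)) (suffix_length_lt g)).
rewrite mulr_sumr [RHS]big_mkcond; apply: eq_bigr => e _ /=.
have en : (e <= n)%N by rewrite -ltnS.
rewrite ltnS leq_suffix_length // unif_suffix_sortedE //.
case: ifP => _; last by rewrite mul0r mulr0.
by rewrite mul1r natrM natrX [LHS]mulrA [LHS]mulrC.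
Qed.

Lemma colored_uniformE g : colored_uniform R n p g = #|{: G}|%:R^-1.
Proof. by rewrite /colored_uniform /unif finset.in_setT cardsT. Qed.

Lemma sum_unif (T : finType) (A : {set T}) : (0 < #|A|)%N -> \sum_x unif R A x = 1.
Proof.
move=> A0; rewrite /unif -big_mkcond /= sumr_const -[LHS]mulr_natl divff //.
by rewrite pnatr_eq0 -lt0n.
Qed.

(** Both laws have mass 1, so half the sum of the absolute differences is the sum
    of the positive parts of the differences. *)
Lemma tv_suffix_mixture w : \sum_(e < n.+1) w e = 1 ->
  tv (suffix_mixture w) (colored_uniform R n p) =
  \sum_(l < n.+1) level_prob l * Num.max (density w l - 1) 0.
Proof.
move=> w1; rewrite -(sum_suffix_length (fun l => Num.max (density w l - 1) 0)).
have G0 := natr_card_neq0 R n p.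
have Gp : 0 < #|{: G}|%:R^-1 :> R by rewrite invr_gt0 lt0r G0 ler0n.
have massM : \sum_g suffix_mixture w g = 1.
  rewrite exchange_big /= -w1; apply: eq_bigr => e _.
  rewrite -mulr_sumr sum_unif ?mulr1 // card_gt0; apply: contraNneq G0.
  have en : (e <= n)%N by rewrite -ltnS.
  by rewrite (card_suffix_sorted p en) => ->; rewrite cards0 muln0.
have massU : \sum_g colored_uniform R n p g = 1.
  by rewrite sum_unif // cardsT; move: G0; rewrite pnatr_eq0 -lt0n.
transitivity (\sum_g (2^-1 * (suffix_mixture w g - colored_uniform R n p g)
    + 2^-1 * `|suffix_mixture w g - colored_uniform R n p g|)).
  by rewrite big_split /= -!mulr_sumr sumrB massM massU subrr mulr0 add0r.
apply: eq_bigr => g _; rewrite suffix_mixtureE colored_uniformE maxr_absE subr0 addr0.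
have -> : #|{: G}|%:R^-1 * density w (suffix_length g) - #|{: G}|%:R^-1 =
  #|{: G}|%:R^-1 * (density w (suffix_length g) - 1) by rewrite mulrBr mulr1.
by rewrite normrM gtr0_norm //; ring.
Qed.

Lemma density_mono w : (forall e, 0 <= w e) -> {homo density w : k l / (k <= l)%N >-> k <= l}.
Proof.
move=> w0 k l kl.
rewrite /density (big_ord_widen l.+1 (fun e => w e * (e`!%:R * p%:R ^+ e))) // big_mkcond.
apply: ler_sum => e _; case: ifP => // _.
by rewrite !mulr_ge0 // exprn_ge0.
Qed.

(** With k = 1 if p = 1 and k = 0 otherwise, k! p^k = 1, so that the k-th suffix
    class is everything, while the next one is proper. *)
Lemma least_suffix_length : (2 <= n)%N ->
  (forall g, ((p == 1) <= suffix_length g)%N) /\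
  exists g, suffix_length g = (p == 1).
Proof.
move=> n2; have le1 : ((p == 1%N) <= 1)%N by case: (p == 1%N).
have lo g : ((p == 1) <= suffix_length g)%N.
  have := card_suffix_sorted p (leq_trans le1 (ltnW n2)).
  rewrite prednK // (_ : ((p == 1%N)`! * p ^ (p == 1%N))%N = 1%N) ?mul1n; last first.
    by case: eqP => [->|].
  move=> h; rewrite leq_suffix_length ?(leq_trans le1 (ltnW n2)) //.
  have /eqP -> : V (p == 1%N) == [set: G]; last by rewrite finset.in_setT.
  by rewrite eqEcard subsetT cardsT h leqnn.
split=> //; set k : nat := (p == 1).
have kn : (k.+1 <= n)%N by apply: leq_trans n2; rewrite ltnS.
have /existsP[g ng] : [exists g, g \notin V k.+1].
  rewrite -negb_forall; apply/negP => /forallP all.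
  have := card_suffix_sorted p kn; rewrite prednK //.
  have -> : #|V k.+1| = #|{: G}| by apply: eq_card => g; rewrite all.
  have G0 : (0 < #|{: G}|)%N by have := natr_card_neq0 R n p; rewrite pnatr_eq0 -lt0n.
  rewrite -[LHS]mul1n => /eqP; rewrite eqn_pmul2r // /k; case: (p =P 1%N) => [->//|p1].
  by rewrite expn1 mul1n eq_sym => /eqP.
exists g; apply/eqP; rewrite eqn_leq lo andbT.
by rewrite -ltnS ltnNge leq_suffix_length.
Qed.

(** The density increases with the suffix length, so the maximum in the
    separation is reached at the least possible suffix length. *)
Lemma sep_suffix_mixture w : (2 <= n)%N -> (forall e, 0 <= w e) ->
  sep (suffix_mixture w) (colored_uniform R n p) = 1 - density w (p == 1%N).
Proof.
move=> n2 w0; have [lo [g0 g0E]] := least_suffix_length n2.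
have G0 := natr_card_neq0 R n p.
have ratio g : suffix_mixture w g / colored_uniform R n p g = density w (suffix_length g).
  by rewrite suffix_mixtureE colored_uniformE invrK mulrAC mulVf // mul1r.
have le g : 1 - suffix_mixture w g / colored_uniform R n p g <= 1 - density w (p == 1%N).
  by rewrite ratio lerD2l lerN2; exact: density_mono.
apply/eqP; rewrite eq_le /sep; apply/andP; split; first exact: bigmax_le.
by rewrite -g0E -ratio; exact: (le_bigmax _ (fun g => 1 - suffix_mixture w g / colored_uniform R n p g)).
Qed.

End Distances.

(** * Limits of the two distances *)

Section DistanceLimits.
Local Open Scope classical_set_scope.
Variables (R : realType) (r : nat) (a : R) (m : nat -> nat) (p : nat).
Hypothesis r2 : (2 <= r)%N.
Hypothesis a0 : 0 < a.
Hypothesis mP : forall n : nat, (2 <= n)%N -> (1 <= m n <= n - 1)%N.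
Hypothesis masym : asym_equiv (fun n : nat => n%:R - (m n)%:R)
                              (fun n : nat => a * n%:R `^ (1 - r%:R^-1)).
Hypothesis p0 : (0 < p)%N.

Lemma convolution_pow_mixture n k s : (k <= n)%N ->
  convolution_pow (top_to_random R n p k) s =
  @suffix_mixture R n p (missed_pmf R n k s).
Proof.
move=> kn; apply/funext => g; rewrite convolution_powE //.
by apply: eq_bigr => e _; rewrite untouched_weightE // -ltnS.
Qed.

Lemma sum_missed_pmf n k s : (k <= n)%N -> \sum_(e < n.+1) missed_pmf R n k s e = 1.
Proof.
move=> kn; have := missed_pmf_moment R s kn (leq0n n).
by rewrite !bin0 divr1 expr1n mulr1; under eq_bigr do rewrite bin0 mulr1.
Qed.

Lemma density_cvg l :
  density p (missed_pmf R n (m n) r) l @[n --> \oo] --> coef_s p l (a ^+ r).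
Proof.
pose f e : R := (a ^+ r) ^+ e / e`!%:R * expR (- a ^+ r) * (e`!%:R * p%:R ^+ e).
have -> : coef_s p l (a ^+ r) = \sum_(e < l.+1) f e.
  rewrite /coef_s big_mkord mulr_sumr; apply: eq_bigr => e _.
  by rewrite /f exprMn; field; exact: natr_fact_neq0.
apply: (@cvgn_sum _ (fun n e => missed_pmf R n (m n) r e * (e`!%:R * p%:R ^+ e)) f) => e.
by apply: cvgM; [exact: missed_pmf_cvg|exact: cvg_cst].
Qed.

Lemma density_ge0 w l : (forall e, 0 <= w e) -> 0 <= density p w l :> R.
Proof. by move=> w0; apply: sumr_ge0 => e _; rewrite !mulr_ge0 // exprn_ge0. Qed.

Lemma level_prob_ge0 n l : 0 <= level_prob R n p l.
Proof.
have pos k : 0 < k`!%:R * p%:R ^+ k :> R by rewrite mulr_gt0 ?exprn_gt0 ?ltr0n ?fact_gt0.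
rewrite /level_prob; case: ifP => _; last by rewrite subr0 invr_ge0 ltW.
rewrite subr_ge0 lef_pV2 ?posrE //; apply: ler_pM => //.
  by rewrite ler_nat factS leq_pmull.
by rewrite ler_weXn2l // ler1n.
Qed.

Lemma level_prob_le n l : level_prob R n p l <= l`!%:R^-1.
Proof.
have pos k : 0 < k`!%:R * p%:R ^+ k :> R by rewrite mulr_gt0 ?exprn_gt0 ?ltr0n ?fact_gt0.
apply: (@le_trans _ _ (l`!%:R * p%:R ^+ l)^-1).
  by rewrite gerBl; case: ifP => // _; rewrite invr_ge0 ltW.
rewrite lef_pV2 ?posrE ?ltr0n ?fact_gt0 // ler_peMr // exprn_ege1 // ler1n //.
Qed.

(** [tannery] applies because, with B = a^r + 1, the density at suffix length l is
    at most the sum of the (p B)^e over e <= l, hence at most (1 + p B)^l,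
    while the level probabilities are at most 1/l!. *)
Lemma tv_cvg :
  tv (convolution_pow (top_to_random R n p (m n)) r) (colored_uniform R n p)
    @[n --> \oo] --> profile_f p (- (r%:R * ln a)).
Proof.
rewrite /profile_f opprK.
have -> : expR (r%:R * ln a) = a ^+ r by rewrite expRM_natl lnK ?posrE.
pose u n l : R := level_prob R n p l * Num.max (density p (missed_pmf R n (m n) r) l - 1) 0.
apply: (@cvgn_near_eq _ _ (fun n => \sum_(l < n.+1) u n l)).
  apply: filterS (near_sizes mP) => n [_ mn].
  by rewrite convolution_pow_mixture // tv_suffix_mixture // sum_missed_pmf.
pose B := a ^+ r + 1; have B0 : 0 <= B by rewrite addr_ge0 // exprn_ge0 // ltW.
apply: (@tannery _ u _ (exp_coeff (1 + p%:R * B))); first exact: is_cvg_series_exp_coeff.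
  move=> l; apply: cvgM; last first.
    by apply: cvgn_max0; apply: cvgB; [exact: density_cvg|exact: cvg_cst].
  apply: (@cvgn_near_eq _ _ (fun=> coef_a R p l)); last exact: cvg_cst.
  near=> n; rewrite /level_prob /coef_a ifT //; near: n; exact: nbhs_infty_gt.
near=> n => l; have [_ mn] : (2 <= n)%N /\ (m n <= n)%N by near: n; exact: near_sizes.
have pmfB e : missed_pmf R n (m n) r e <= B ^+ e / e`!%:R.
  apply: le_trans (missed_pmf_le_moment R r e mn) _.
  by move: e; near: n; exact: near_moment_le.
have d0 : 0 <= density p (missed_pmf R n (m n) r) l.
  by apply: density_ge0 => e; exact: missed_pmf_ge0.
rewrite ger0_norm; last by rewrite mulr_ge0 ?level_prob_ge0 // le_max lexx orbT.
rewrite /u /exp_coeff /= [leRHS]mulrC; apply: ler_pM; rewrite ?level_prob_ge0 ?level_prob_le //.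
  by rewrite le_max lexx orbT.
apply: (@le_trans _ _ (density p (missed_pmf R n (m n) r) l)).
  by rewrite ge_max d0 andbT gerBl.
rewrite exprDn; apply: ler_sum => e _.
rewrite expr1n mul1r exprMn -[leRHS]mulr_natr -[leLHS]mulr1; apply: ler_pM => //.
- by rewrite !mulr_ge0 ?missed_pmf_ge0 ?exprn_ge0.
- rewrite mulrA mulrC ler_wpM2l ?exprn_ge0 // -ler_pdivlMr ?ltr0n ?fact_gt0 //.
- by rewrite ler1n bin_gt0 -ltnS.
Unshelve. all: by end_near.
Qed.

Lemma sep_cvg :
  sep (convolution_pow (top_to_random R n p (m n)) r) (colored_uniform R n p)
    @[n --> \oo] --> (if p == 1%N then 1 - expR (- a ^+ r) * (1 + a ^+ r)
                      else 1 - expR (- a ^+ r) : R).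
Proof.
have -> : (if p == 1%N then 1 - expR (- a ^+ r) * (1 + a ^+ r)
           else 1 - expR (- a ^+ r)) = 1 - coef_s p (p == 1%N) (a ^+ r).
  rewrite /coef_s; case: eqP => [->|_]; rewrite ?big_nat_recr //= big_nil ?expr0 ?expr1 ?mul1r ?add0r ?mulr1 //.
apply: (@cvgn_near_eq _ _ (fun n => 1 - density p (missed_pmf R n (m n) r) (p == 1%N))).
  apply: filterS (near_sizes mP) => n [n2 mn].
  rewrite convolution_pow_mixture // sep_suffix_mixture // => e.
  exact: missed_pmf_ge0.
by apply: cvgB; [exact: cvg_cst|exact: density_cvg].
Qed.

End DistanceLimits.

(** * The theorem *)

Unset Implicit Arguments.
Local Open Scope classical_set_scope.

Theorem corollary5p4 (R : realType) (r : nat) (a : R) (m : nat -> nat)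
    (hr : (2 <= r)%N) (ha : 0 < a)
    (hm : forall n : nat, (2 <= n)%N -> (1 <= m n <= n - 1)%N)
    (hasym : asym_equiv (fun n : nat => n%:R - (m n)%:R)
                        (fun n : nat => a * n%:R `^ (1 - r%:R^-1))) :
  cvg_in_distribution (fun n : nat => missed_cdf R n (m n) r)
                      (poisson_cdf (a ^+ r))
  /\ forall p : nat, (1 <= p)%N ->
       (tv (convolution_pow (top_to_random R n p (m n)) r) (colored_uniform R n p)
          @[n --> \oo] --> profile_f p (- (r%:R * ln a)))
       /\ (sep (convolution_pow (top_to_random R n p (m n)) r) (colored_uniform R n p)
          @[n --> \oo] --> (if p == 1%N then 1 - expR (- a ^+ r) * (1 + a ^+ r)
                            else 1 - expR (- a ^+ r) : R)).
Proof.
split=> [x _|p p0]; first exact: missed_cdf_cvg.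
by split; [exact: tv_cvg|exact: sep_cvg].
Qed.
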